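(* Let $(W,S)$ be an irreducible Fuchsian Coxeter system and let $(\Delta,\delta)$ be a thick regular Fuchsian building of type $(W,S)$, with fixed base chamber $o\in\Delta$. Let $(X_n)_{n\ge0}$ be an irreducible isotropic random walk on $\Delta$ with bounded range and $X_0=o$, let $\pi_n$ be the distribution of $X_n$, and let $h=\lim_{n\to\infty}-\frac1n\mathbb E[\log\pi_n(X_n)]$ be its asymptotic entropy (this limit exists). Then: 1. $h=\liminf_{n\to\infty}-\frac1n\log\pi_n(X_n)$ almost surely. 2. $-\frac1n\log\pi_n(X_n)\to h$ in $L_1$ as $n\to\infty$.
   Context: Fuchsian Coxeter system: $S=\{s_1,\dots,s_N\}$ with $N\ge3$, and there are integers $k_1,\dots,k_N\ge2$ with $\sum_{i=1}^N 1/k_i<N-2$ such that $W$ is generated by $S$ subject to $s_i^2=e$ and $(s_is_{i+1})^{k_i}=e$ (indices cyclic, $N+1\equiv1$), with no relation between other pairs of generators. $\ell$ is word length on $W$ with respect to $S$, and $e$ is the neutral element. Building: a Fuchsian building of type $(W,S)$ is a nonempty set $\Delta$ (of chambers) with a map $\delta:\Delta\times\Delta\to W$ such that for all $x,y\in\Delta$: (B1) $\delta(x,y)=e$ iff $x=y$; (B2) if $\delta(x,y)=w$ and $\delta(y,z)=s\in S$, then $\delta(x,z)\in\{w,ws\}$, and $\delta(x,z)=ws$ if $\ell(ws)=\ell(w)+1$; (B3) if $\delta(x,y)=w$ and $s\in S$, there is $z\in\Delta$ with $\delta(y,z)=s$ and $\delta(x,z)=ws$. It is regular if for each $s\in S$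 the number $q_s=|\{y\mid\delta(x,y)=s\}|$ is finite and independent of $x\in\Delta$, and thick if $|\{y\mid\delta(x,y)=s\}|\ge2$ for all $x\in\Delta$, $s\in S$. Random walk: a time-homogeneous random walk (Markov chain) $(X_n)_{n\geq 0}$ on $\Delta$ with transition probabilities $p(x,y)$ is isotropic if $p(x,y)=p(x',y')$ whenever $\delta(x,y)=\delta(x',y')$. Bounded range means there is $L_0$ such that $p(x,y)>0$ implies $\ell(\delta(x,y))\le L_0$. *)

(* Defs.v *)
From HB Require Import structures.
From mathcomp Require Import all_boot all_order all_fingroup all_algebra.
From mathcomp Require Import all_classical all_reals all_analysis.

Set Implicit Arguments.
Unset Strict Implicit.
Unset Printing Implicit Defensive.

Import Order.TTheory GRing.Theory Num.Theory.
Import numFieldNormedType.Exports.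

Local Open Scope classical_set_scope.
Local Open Scope ring_scope.

Section Coxeter.
Variables (N : nat) (W : groupType) (s : 'I_N -> W).

Definition word_value (u : seq 'I_N) : W :=
  foldr (fun i w => (s i * w)%g) 1%g u.

(* [ordS] is the successor in the cyclic order on 'I_N. *)
Inductive relator (k : 'I_N -> nat) : seq 'I_N -> Prop :=
| relator_involution i : relator k [:: i; i]
| relator_edge i : relator k (flatten (nseq (k i) [:: i; ordS i])).

(* The congruence on words generated by the relators.  Words in the letters
   s_i suffice (no formal inverses) because every s_i is an involution. *)
Inductive word_congr (k : 'I_N -> nat) : seq 'I_N -> seq 'I_N -> Prop :=
| word_congr_refl u : word_congr k u u
| word_congr_sym u v : word_congr k u v -> word_congr k v u
| word_congr_trans u v w :
    word_congr k u v -> word_congr k v w -> word_congr k u w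
| word_congr_relator u r v :
    relator k r -> word_congr k (u ++ r ++ v) (u ++ v).

(* W = < s_i | s_i ^ 2, (s_i s_(i+1)) ^ (k_i) > *)
Record presented_by (k : 'I_N -> nat) : Prop := {
  presented_generation : forall w, exists u, word_value u = w;
  presented_relations :
    forall u v, word_value u = word_value v <-> word_congr k u v }.

Definition fuchsian_coxeter_system : Prop :=
  exists k : 'I_N -> nat,
    [/\ (3 <= N)%N,
        forall i, (2 <= k i)%N,
        \sum_(i < N) (k i)%:R^-1 < N%:R - 2 :> rat
      & presented_by k].

(* S is not the union of two nonempty disjoint subsets commuting with each
   other, i.e. the Coxeter graph is connected. *)
Definition irreducible_coxeter_system : Prop :=
  forall J : {set 'I_N}, J != finset.set0 -> J != [set: 'I_N]%SET ->
    exists i j, [/\ i \in J, j \notin J & (s i * s j)%g <> (s j * s i)%g].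

Definition word_of_size (w : W) (n : nat) : Prop :=
  exists2 u, size u = n & word_value u = w.

Definition cox_length (w : W) : nat :=
  xget 0%N [set n | word_of_size w n /\
                    forall m, word_of_size w m -> (n <= m)%N].

Section Building.
Variables (D : Type) (delta : D -> D -> W).

Record building : Prop := {
  building_B1 : forall x y, delta x y = 1%g <-> x = y;
  building_B2 : forall x y z i, delta y z = s i ->
    (delta x z = delta x y \/ delta x z = (delta x y * s i)%g) /\
    (cox_length (delta x y * s i)%g = (cox_length (delta x y)).+1 ->
     delta x z = (delta x y * s i)%g);
  building_B3 : forall x y i,
    exists z, delta y z = s i /\ delta x z = (delta x y * s i)%g }.

Definition regular_building : Prop :=
  exists q : 'I_N -> nat,
    forall i x, ([set y | delta x y = s i] #= `I_(q i))%card.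

Definition thick_building : Prop :=
  forall x i, (`I_2 #<= [set y | delta x y = s i])%card.

End Building.
End Coxeter.

Section RandomWalk.
Variables (R : realType) (D : choiceType).

Definition transition_matrix (p : D -> D -> R) : Prop :=
  (forall x y, 0 <= p x y) /\
  (forall x, (\esum_(y in [set: D]) (p x y)%:E = 1)%E).

Fixpoint transition_iter (p : D -> D -> R) (n : nat) (x y : D) : \bar R :=
  if n is m.+1 then
    (\esum_(z in [set: D]) ((p x z)%:E * transition_iter p m z y))%E
  else ((x == y)%:R : R)%:E.

Definition irreducible_walk (p : D -> D -> R) : Prop :=
  forall x y, exists n, (0 < transition_iter p n x y)%E.

Definition isotropic (W : Type) (delta : D -> D -> W) (p : D -> D -> R) :
    Prop :=
  forall x y x' y', delta x y = delta x' y' -> p x y = p x' y'.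

Definition bounded_range (N : nat) (W : groupType) (s : 'I_N -> W)
    (delta : D -> D -> W) (p : D -> D -> R) : Prop :=
  exists L0 : nat, forall x y, 0 < p x y -> (cox_length s (delta x y) <= L0)%N.

Context {d : measure_display} {T : measurableType d} (P : probability T R).

(* The state space carries the discrete sigma-algebra. *)
Record markov_chain (p : D -> D -> R) (o : D) (X : nat -> T -> D) : Prop := {
  markov_measurable : forall n (A : set D), measurable (X n @^-1` A);
  markov_start : {ae P, forall t, X 0%N t = o};
  markov_step : forall (n : nat) (x : nat -> D),
    (P [set t | forall i, (i <= n.+1)%N -> X i t = x i] =
     P [set t | forall i, (i <= n)%N -> X i t = x i] *
       (p (x n) (x n.+1))%:E)%E }.

Definition law (X : nat -> T -> D) (n : nat) (x : D) : R :=
  fine (P (X n @^-1` [set x])).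

End RandomWalk.

(* Main.v *)
(* Proof idea.  Write phi_n(x, y) = - ln p_n(x, y).  The structure constants of
   a regular building make p_n isotropic, and make the law of the process
   (delta(X_k, X_(k+j)))_j independent of k; this plays the role that group
   invariance plays for random walks on groups.  Since
   phi_(m+n)(x, z) <= phi_m(x, y) + phi_n(y, z), the entropies
   H_n = E phi_n(o, X_n) are subadditive and H_n / n tends to its infimum h.

   L1 convergence: phi_(jm)(o, X_(jm)) is at most a sum of j blocks
   phi_m(X_(im), X_((i+1)m)) which have mean H_m and are uncorrelated; the sum
   concentrates at j H_m by Chebyshev, and the expected defect j H_m - H_(jm) is
   at most j m (H_m / m - h).

   Almost sure lower bound: fix a horizon K and put g_k = phi_(K-k)(X_k, X_K),
   so that phi_n(X_k, X_(k+n)) >= g_k - g_(k+n).  If phi_n(X_k, X_(k+n)) dips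
   below n (h - lam) for some n <= M, then the positive parts of
   h - (g_j - g_(j+1)) add up to more than lam n on [k, k+n).  A covering
   argument bounds the number of such k, and as all k are equally likely to be
   bad, the probability of a dip is at most (E|phi_1 - h| + H_1 - h) / lam.
   Applied to the m-step chain with m large, this is arbitrarily small.  L1
   convergence gives the opposite inequality for the lower limit. *)
Require Import Defs.
From HB Require Import structures.
From mathcomp Require Import all_boot all_order all_fingroup all_algebra.
From mathcomp Require Import all_classical all_reals all_analysis.
From mathcomp Require Import finmap ring lra zify.

Set Implicit Arguments.
Unset Strict Implicit.
Unset Printing Implicit Defensive.

Import Order.TTheory GRing.Theory Num.Theory.
Import numFieldNormedType.Exports.

Local Open Scope classical_set_scope.
Local Open Scope ring_scope.

(* Vitali-type covering in one dimension: greedily cut off an interval of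
   length n starting at each bad point not yet covered. *)
Lemma covering_sum (R : realDomainType) (a : nat -> R) (bad : pred nat)
    (lam : R) (L M : nat) :
  0 <= lam -> (forall k, 0 <= a k) ->
  (forall k, (k < L)%N -> bad k -> exists n, [/\ (0 < n)%N, (n <= M)%N &
    n%:R * lam <= \sum_(k <= j < k + n) a j]) ->
  lam * \sum_(0 <= k < L) (bad k)%:R <= \sum_(0 <= j < L + M) a j.
Proof.
move=> lam0 a0 hbad.
have a_sum0 m n : 0 <= \sum_(m <= j < n) a j by apply: sumr_ge0.
suff H d k0 : (L - k0 <= d)%N ->
    lam * \sum_(k0 <= k < L) (bad k)%:R <= \sum_(k0 <= j < L + M) a j.
  exact: (H L 0%N (leq_subr _ _)).
elim: d k0 => [|d IH] k0 hd.
  by rewrite big_geq ?mulr0//; rewrite leqn0 subn_eq0 in hd.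
have [Lk|kL] := leqP L k0; first by rewrite big_geq ?mulr0.
have [bk|/negPf bk] := boolP (bad k0); last first.
  rewrite big_ltn// bk add0r [leRHS]big_ltn; last by lia.
  by rewrite -[leLHS]add0r lerD// IH//; lia.
have [n [n0 nM hn]] := hbad _ kL bk.
rewrite (big_cat_nat (n := (k0 + n)%N) (p := (L + M)%N)) /=; [|lia..].
have count_le m1 m2 : (\sum_(m1 <= k < m2) (bad k)%:R : R) <= (m2 - m1)%:R.
  rewrite -[leRHS]mulr1 mulr_natl -sumr_const_nat; apply: ler_sum => k _.
  by rewrite lern1; case: (bad k).
have [kn|kn] := leqP L (k0 + n).
  apply: (@le_trans _ _ (n%:R * lam)); last first.
    by rewrite -[leLHS]addr0 lerD.
  rewrite mulrC ler_wpM2r//; apply: le_trans (count_le _ _) _.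
  by rewrite ler_nat; lia.
rewrite (big_cat_nat (n := (k0 + n)%N)) /=; [|lia..].
rewrite mulrDr lerD//; last by apply: IH; lia.
apply: le_trans hn; rewrite mulrC ler_wpM2r//.
by apply: le_trans (count_le _ _) _; rewrite addKn.
Qed.

(** * Trajectories: concatenation and dependence on the past *)

Section Trajectories.
Variables (D : Type).

Definition scons (x : D) (u : nat -> D) (k : nat) : D :=
  if k is j.+1 then u j else x.

(** Time [n] is read from [v]; in use [v] starts at [u n], so the two pieces agree at the seam. *)
Definition glue (n : nat) (u v : nat -> D) (k : nat) : D :=
  if (k < n)%N then u k else v (k - n)%N.

Lemma glue0 u v : glue 0 u v = v.
Proof. by apply/funext => k; rewrite /glue ltn0 subn0. Qed.

Lemma scons_glue n x u v : scons x (glue n u v) = glue n.+1 (scons x u) v.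
Proof. by apply/funext => -[|k]; rewrite /glue //= ltnS subSS. Qed.

Lemma glue_addn n u v k : glue n u v (n + k) = v k.
Proof. by rewrite /glue ltnNge leq_addr addKn. Qed.

(** Stands for measurability with respect to the sigma-algebra of times [0] to [n]. *)
Definition past_event (n : nat) (A : Type) (Q : (nat -> D) -> A) : Prop :=
  forall u v, (forall i, (i <= n)%N -> u i = v i) -> Q u = Q v.

End Trajectories.

(** * Finite-horizon expectations and transition probabilities as finite sums *)

Section Expectation.
Variables (R : realType) (D : choiceType).
Variables (p : D -> D -> R) (supp : D -> seq D).

(* Expectation of F over the trajectory of the chain started at x, stopped
   (frozen) at time n. *)
Fixpoint pexp (n : nat) (x : D) (F : (nat -> D) -> R) : R :=
  if n is m.+1 then
    \sum_(y <- supp x) p x y * pexp m y (fun u => F (scons x u))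
  else F (fun=> x).

Fixpoint pn (n : nat) (x y : D) : R :=
  if n is m.+1 then \sum_(z <- supp x) p x z * pn m z y else (x == y)%:R.

Fixpoint reach (n : nat) (x : D) : seq D :=
  if n is m.+1 then undup (flatten [seq reach m z | z <- supp x]) else [:: x].

(** These trajectories carry all the mass of [pexp n x], so almost sure inequalities become
    inequalities on them. *)
Definition supported (n : nat) (x : D) (u : nat -> D) : Prop :=
  u 0%N = x /\ forall i, (i < n)%N -> u i.+1 \in supp (u i).

Lemma supported_scons n x y u :
  y \in supp x -> supported n y u -> supported n.+1 x (scons x u).
Proof. by move=> yx [u0 hu]; split=> // -[|i] /=; [rewrite u0|apply: hu]. Qed.

Lemma supported_reach n x u : supported n x u -> u n \in reach n x.
Proof.
elim: n x u => [|n IH] x u [u0 hu] /=; first by rewrite u0 mem_seq1.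
rewrite mem_undup; apply/flattenP; exists (reach n (u 1%N)).
  by apply: map_f; rewrite -u0; apply: hu.
by apply: (IH _ (fun k => u k.+1)); split=> // i hi; apply: hu.
Qed.

Lemma supported_step x u n r : supported (n + r) x u ->
  supported r (u n) (fun k => u (n + k)%N).
Proof.
move=> [_ hu]; split=> [|i ir]; first by rewrite addn0.
by rewrite addnS; apply: hu; rewrite ltn_add2l.
Qed.

Lemma supported_reachD n x u k l : (k + l <= n)%N -> supported n x u ->
  u (k + l)%N \in reach l (u k).
Proof.
move=> kln hu.
apply: (@supported_reach l (u k) (fun i => u (k + i)%N)).
apply: (@supported_step x); case: hu => u0 hu; split=> // i ik.
by apply: hu; lia.
Qed.

Lemma eq_pexp n x F G :
  (forall u, supported n x u -> F u = G u) -> pexp n x F = pexp n x G.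
Proof.
elim: n x F G => [|n IH] x F G FG /=; first by apply: FG; split.
rewrite big_seq [RHS]big_seq; apply: eq_bigr => y yx; congr (_ * _).
by apply: IH => u hu; apply: FG; apply: supported_scons hu.
Qed.

Lemma pexpD n x F G :
  pexp n x (fun u => F u + G u) = pexp n x F + pexp n x G.
Proof.
elim: n x F G => [|n IH] x F G //=.
by rewrite -big_split /=; apply: eq_bigr => y _; rewrite IH mulrDr.
Qed.

Lemma pexpZ n x c F : pexp n x (fun u => c * F u) = c * pexp n x F.
Proof.
elim: n x F => [|n IH] x F //=.
by rewrite mulr_sumr; apply: eq_bigr => y _; rewrite IH mulrCA.
Qed.

Lemma pexpB n x F G :
  pexp n x (fun u => F u - G u) = pexp n x F - pexp n x G.
Proof.
rewrite pexpD; congr (_ + _); rewrite -mulN1r -pexpZ.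
by apply: eq_pexp => u _; rewrite mulN1r.
Qed.

Lemma pexp_start n x (F : D -> (nat -> D) -> R) :
  pexp n x (fun u => F (u 0%N) u) = pexp n x (F x).
Proof. by apply: eq_pexp => u [->]. Qed.

(** The Markov property at the fixed time [m]: the law of the continuation depends on the past only
    through [u m]. *)
Lemma pexp_glue m n x F :
  pexp (m + n) x F =
  pexp m x (fun u => pexp n (u m) (fun v => F (glue m u v))).
Proof.
elim: m x F => [|m IH] x F /=.
  by apply: eq_pexp => u _; rewrite glue0.
apply: eq_bigr => y _; rewrite IH; congr (_ * _).
by apply: eq_pexp => u _; apply: eq_pexp => v _; rewrite scons_glue.
Qed.

Lemma pn_pexp n x y : pn n x y = pexp n x (fun u => (u n == y)%:R).
Proof.
by elim: n x => [|n IH] x //=; apply: eq_bigr => z _; rewrite IH.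
Qed.

Hypothesis supp_gt0 : forall x y, y \in supp x -> 0 < p x y.
Hypothesis p_sum1 : forall x, \sum_(y <- supp x) p x y = 1.

Lemma pexp_cst n x c : pexp n x (fun=> c) = c.
Proof.
elim: n x => [|n IH] x //=.
by under eq_bigr do rewrite IH; rewrite -mulr_suml p_sum1 mul1r.
Qed.

Lemma le_pexp n x F G :
  (forall u, supported n x u -> F u <= G u) -> pexp n x F <= pexp n x G.
Proof.
elim: n x F G => [|n IH] x F G FG /=; first by apply: FG; split.
rewrite big_seq [leRHS]big_seq; apply: ler_sum => y yx.
rewrite ler_wpM2l ?(ltW (supp_gt0 yx))//.
by apply: IH => u hu; apply: FG; apply: supported_scons hu.
Qed.

Lemma pexp_ge0 n x F : (forall u, supported n x u -> 0 <= F u) ->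
  0 <= pexp n x F.
Proof. by move=> F0; rewrite -(pexp_cst n x 0); exact: le_pexp. Qed.

Lemma pexp_past m n x F : past_event m F -> pexp (m + n) x F = pexp m x F.
Proof.
move=> hF; rewrite pexp_glue; apply: eq_pexp => u _.
rewrite -[RHS](pexp_cst n (u m)); apply: eq_pexp => v [v0 _].
by apply: hF => i; rewrite leq_eqVlt /glue => /predU1P[->|->//];
  rewrite ltnn subnn.
Qed.

Lemma pexp_past_le m n x F : (m <= n)%N -> past_event m F ->
  pexp n x F = pexp m x F.
Proof. by move=> /subnKC <-; exact: pexp_past. Qed.

Lemma reach_uniq n x : uniq (reach n x).
Proof. by case: n => //= n; rewrite undup_uniq. Qed.

Lemma pn_ge0 n x y : 0 <= pn n x y.
Proof. by rewrite pn_pexp; apply: pexp_ge0. Qed.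

Lemma pn_gt0 n x y : y \in reach n x -> 0 < pn n x y.
Proof.
elim: n x => [|n IH] x /=; first by rewrite mem_seq1 => /eqP->; rewrite eqxx.
rewrite mem_undup => /flattenP[s /mapP[z zx ->] yz].
rewrite (perm_big _ (perm_to_rem zx)) big_cons ltr_pwDl//.
  by rewrite mulr_gt0 ?supp_gt0 ?IH.
rewrite big_seq sumr_ge0// => t /mem_rem /supp_gt0/ltW tx.
by rewrite mulr_ge0// pn_ge0.
Qed.

(** [pn n x] is the law of [u n]: on a supported trajectory exactly one indicator of [u n == y],
    with [y] in [reach n x], is nonzero. *)
Lemma pn_sum n x g :
  \sum_(y <- reach n x) pn n x y * g y = pexp n x (fun u => g (u n)).
Proof.
transitivity (pexp n x (fun u => \sum_(y <- reach n x) (u n == y)%:R * g y)).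
  elim: (reach n x) => [|y r IH].
    by under [RHS]eq_pexp do rewrite big_nil; rewrite pexp_cst big_nil.
  under [RHS]eq_pexp do rewrite big_cons mulrC.
  by rewrite big_cons pexpD -IH pexpZ pn_pexp mulrC.
apply: eq_pexp => u /supported_reach un.
rewrite (bigD1_seq (u n))// ?reach_uniq//= eqxx mul1r big1 ?addr0// => y.
by rewrite eq_sym => /negPf->; rewrite mul0r.
Qed.

Lemma pn_sum1 n x : \sum_(y <- reach n x) pn n x y = 1.
Proof.
rewrite -[RHS](pexp_cst n x) -(pn_sum n x (fun=> 1)).
by under [RHS]eq_bigr do rewrite mulr1.
Qed.

Lemma pn_le1 n x y : pn n x y <= 1.
Proof.
rewrite pn_pexp -[leRHS](pexp_cst n x); apply: le_pexp => u _.
by rewrite lern1; case: eqP.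
Qed.

(** Chapman-Kolmogorov with every intermediate state except [y] dropped. *)
Lemma pn_mul_le m n x y z : pn m x y * pn n y z <= pn (m + n) x z.
Proof.
rewrite [leRHS]pn_pexp pexp_glue pn_pexp mulrC -pexpZ; apply: le_pexp => u _.
case: eqP => [->|_]; last by rewrite mulr0; apply: pexp_ge0.
by rewrite mulr1 pn_pexp; apply: le_pexp => v _; rewrite glue_addn.
Qed.

End Expectation.

(** * Isotropic chains and their invariance *)

Section IsotropicChain.
Variables (R : realType) (D : choiceType) (W : Type).

(* The law of [tau x X_1] under X_0 = y depends only on [tau x y]; a pair g, g'
   of functions agreeing along tau stands for a function on W. *)
Definition lumpable (tau : D -> D -> W) (p : D -> D -> R) (supp : D -> seq D) :
    Prop :=
  forall x y x' y' (g g' : D -> R), tau x y = tau x' y' ->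
    (forall z z', tau x z = tau x' z' -> g z = g' z') ->
    \sum_(z <- supp y) p y z * g z = \sum_(z <- supp y') p y' z * g' z.

(* An abstraction of isotropic bounded-range walks on a regular building. *)
Record isotropic_chain (delta : D -> D -> W) (p : D -> D -> R)
    (supp : D -> seq D) (e : R) : Prop := {
  chain_uniq : forall x, uniq (supp x);
  chain_e_gt0 : 0 < e;
  chain_ge : forall x y, y \in supp x -> e <= p x y;
  chain_sum1 : forall x, \sum_(y <- supp x) p x y = 1;
  chain_refl : forall x y, delta x x = delta y y;
  chain_diag : forall x y x' y', delta x y = delta x' y' -> x = y -> x' = y';
  chain_forward : lumpable delta p supp;
  chain_backward : lumpable (fun x y => delta y x) p supp }.

(** Induction on [n] with the observer [x] fixed: [lumpable] handles one step of the moving point,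
    and the new relative position is all that the remaining steps need. *)
Lemma pexp_lumpable tau (p : D -> D -> R) supp n x y x' y' F F' :
  lumpable tau p supp -> tau x y = tau x' y' ->
  (forall u u', (forall i, tau x (u i) = tau x' (u' i)) -> F u = F' u') ->
  pexp p supp n y F = pexp p supp n y' F'.
Proof.
move=> lump; elim: n y y' F F' => [|n IH] y y' F F' xy FF' /=; first exact: FF'.
apply: (lump _ _ _ _ _ _ xy) => z z' xz; apply: IH => // u u' uu'.
by apply: FF' => -[|i] /=; [exact: xy|exact: uu'].
Qed.

Variables (delta : D -> D -> W) (p : D -> D -> R) (supp : D -> seq D) (e : R).
Hypothesis chain : isotropic_chain delta p supp e.

Let e_gt0 := chain_e_gt0 chain.
Let sum1 := chain_sum1 chain.
Let diag := chain_diag chain.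

Lemma chain_gt0 x y : y \in supp x -> 0 < p x y.
Proof. by move=> /(chain_ge chain); apply: lt_le_trans. Qed.

Lemma chain_inhabited x : exists y, y \in supp x.
Proof.
case E : (supp x) => [|y s]; last by exists y; rewrite mem_head.
by move/eqP: (sum1 x); rewrite E big_nil eq_sym oner_eq0.
Qed.

Lemma chain_e_le1 (x : D) : e <= 1.
Proof.
have [y yx] := chain_inhabited x; apply: le_trans (chain_ge chain yx) _.
rewrite -(sum1 x) (bigD1_seq y)//= ?(chain_uniq chain)// lerDl big_seq_cond.
by apply: sumr_ge0 => z /andP[/chain_gt0/ltW].
Qed.

(** The walk is observed from its target: its position relative to [y] evolves by [chain_backward],
    and arrival at [y] is visible in that position by [chain_diag]. *)
Lemma pn_isotropic n x y x' y' : delta x y = delta x' y' ->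
  pn p supp n x y = pn p supp n x' y'.
Proof.
move=> xy; rewrite !pn_pexp; apply: (pexp_lumpable _ (chain_backward chain) xy).
move=> u u' /(_ n) uu'; congr ((nat_of_bool _)%:R); apply/eqP/eqP.
  exact: (diag uu').
exact: (diag (esym uu')).
Qed.

Lemma pn_ge n x y : y \in reach supp n x -> e ^+ n <= pn p supp n x y.
Proof.
elim: n x => [|n IH] x /=.
  by rewrite mem_seq1 eq_sym => ->; rewrite expr0.
rewrite mem_undup => /flattenP[s /mapP[z zx ->] yz].
rewrite (bigD1_seq z)//= ?(chain_uniq chain)// -[leLHS]addr0 exprS lerD//.
  by rewrite ler_pM ?exprn_ge0 ?(ltW e_gt0)// ?(chain_ge chain)// IH.
rewrite big_seq_cond sumr_ge0// => t /andP[/chain_gt0/ltW tx _].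
by rewrite mulr_ge0// pn_ge0//; exact: chain_gt0.
Qed.

(** The [m]-step chain stays in the class, so one-step estimates can be reused on long blocks. *)
Lemma iter_chain m :
  isotropic_chain delta (pn p supp m) (reach supp m) (e ^+ m).
Proof.
split.
- by move=> x; exact: reach_uniq.
- by rewrite exprn_gt0.
- exact: pn_ge.
- by move=> x; exact: pn_sum1.
- exact: chain_refl chain.
- exact: diag.
- move=> x y x' y' g g' xy gg'.
  rewrite !(pn_sum sum1).
  apply: (pexp_lumpable _ (chain_forward chain) xy) => u u' uu'.
  exact: gg'.
- move=> x y x' y' g g' xy gg'.
  rewrite !(pn_sum sum1).
  apply: (pexp_lumpable _ (chain_backward chain) xy) => u u' uu'.
  exact: gg'.
Qed.

Lemma pexp_sample m n x F : (0 < m)%N ->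
  pexp (pn p supp m) (reach supp m) n x F =
  pexp p supp (n * m) x (fun u => F (fun k => u (k * m)%N)).
Proof.
move=> m0; elim: n x F => [|n IH] x F //=.
under eq_bigr do rewrite IH.
rewrite mulSn pexp_glue.
rewrite (pn_sum sum1 m x (fun y => pexp p supp (n * m) y
  (fun u => F (scons x (fun k => u (k * m)%N))))).
apply: eq_pexp => u [u0 _]; apply: eq_pexp => v _.
congr F; apply/funext => -[|k] /=; first by rewrite /glue m0.
by rewrite mulSn glue_addn.
Qed.

Lemma pn_sample m n x y :
  pn (pn p supp m) (reach supp m) n x y = pn p supp (n * m) x y.
Proof.
case: m => [|m]; last by rewrite !pn_pexp pexp_sample.
rewrite muln0; elim: n x => [//|n IH] x /=.
by rewrite big_seq1 eqxx mul1r IH.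
Qed.

Lemma pexp_homogeneous n x y F F' :
  (forall u u', (forall i, delta x (u i) = delta y (u' i)) -> F u = F' u') ->
  pexp p supp n x F = pexp p supp n y F'.
Proof.
exact: pexp_lumpable (chain_forward chain) (chain_refl chain x y).
Qed.

Lemma pexp_shift m n x (G : (nat -> D) -> R) :
  pexp p supp (m + n) x (fun u => G (fun k => u (m + k)%N)) =
  pexp p supp m x (fun u => pexp p supp n (u m) G).
Proof.
rewrite pexp_glue; apply: eq_pexp => u _; apply: eq_pexp => v _.
by congr G; apply/funext => k; rewrite glue_addn.
Qed.

(** * Surprisal and entropy *)

Definition surprisal n x y : R := - ln (pn p supp n x y).
Definition entropy n x : R := pexp p supp n x (fun u => surprisal n x (u n)).

Lemma surprisal_ge0 n x y : 0 <= surprisal n x y.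
Proof. by rewrite oppr_ge0 ln_le0// pn_le1//; exact: chain_gt0. Qed.

Lemma surprisal0 x : surprisal 0 x x = 0.
Proof. by rewrite /surprisal /= eqxx ln1 oppr0. Qed.

Lemma surprisal_le n x y : y \in reach supp n x ->
  surprisal n x y <= n%:R * - ln e.
Proof.
move=> xy; rewrite mulrN mulr_natl -lnXn// lerN2 ler_ln ?posrE ?exprn_gt0//.
  exact: pn_ge.
by apply: pn_gt0 => //; exact: chain_gt0.
Qed.

(** The logarithm of [pn_mul_le]. Since [ln] takes the value 0 at 0, an unreachable state has
    surprisal 0 instead of infinity, hence the reachability hypotheses. *)
Lemma surprisal_subadd m n x y z :
  y \in reach supp m x -> z \in reach supp n y ->
  surprisal (m + n) x z <= surprisal m x y + surprisal n y z.
Proof.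
move=> xy yz.
have xy0 := pn_gt0 chain_gt0 sum1 xy; have yz0 := pn_gt0 chain_gt0 sum1 yz.
have le_mn := pn_mul_le chain_gt0 sum1 m n x y z.
rewrite /surprisal -opprD lerN2 -lnM ?posrE// ler_ln ?posrE ?mulr_gt0//.
by apply: lt_le_trans le_mn; rewrite mulr_gt0.
Qed.

Lemma surprisal_isotropic n x y x' y' : delta x y = delta x' y' ->
  surprisal n x y = surprisal n x' y'.
Proof. by move=> xy; rewrite /surprisal (pn_isotropic n xy). Qed.

Lemma entropy_homogeneous n x y : entropy n x = entropy n y.
Proof. by apply: pexp_homogeneous => u u' uu'; exact: surprisal_isotropic. Qed.

(** Whatever state is occupied at time [m], the next [r] steps have conditional mean [c]. *)
Lemma pexp_window m r n x (G : (nat -> D) -> R) c : (m + r <= n)%N ->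
  past_event r G -> (forall y, pexp p supp r y G = c) ->
  pexp p supp n x (fun u => G (fun k => u (m + k)%N)) = c.
Proof.
move=> mrn hG Gc; have -> : n = (m + (n - m))%N by lia.
rewrite pexp_shift -[RHS](pexp_cst sum1 m x); apply: eq_pexp => u _.
by rewrite (pexp_past_le sum1 _ _ hG)//; lia.
Qed.

Lemma pexp_surprisal m r n x y : (m + r <= n)%N ->
  pexp p supp n x (fun u => surprisal r (u m) (u (m + r)%N)) = entropy r y.
Proof.
move=> mrn.
rewrite -(@pexp_window m r n x (fun v => surprisal r (v 0%N) (v r))
  (entropy r y))//.
- by apply: eq_pexp => u _; rewrite addn0.
- by move=> u v uv; rewrite !uv.
- by move=> z; rewrite (pexp_start _ _ _ _ (fun a v => surprisal r a (v r)))
    (entropy_homogeneous r y z).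
Qed.

Lemma entropy_ge0 n x : 0 <= entropy n x.
Proof.
by apply: (pexp_ge0 chain_gt0 sum1) => u _; exact: surprisal_ge0.
Qed.

Lemma entropy_le n x : entropy n x <= n%:R * - ln e.
Proof.
rewrite -[leRHS](pexp_cst sum1 n x); apply: (le_pexp chain_gt0) => u hu.
exact/surprisal_le/supported_reach.
Qed.

Lemma entropy_subadd m n x : entropy (m + n) x <= entropy m x + entropy n x.
Proof.
rewrite -(@pexp_surprisal 0 m (m + n) x x) ?leq_addr//.
rewrite -(@pexp_surprisal m n (m + n) x x)// -pexpD.
apply: (le_pexp chain_gt0) => u hu.
rewrite add0n; case: (hu) => -> _; apply: surprisal_subadd.
  by case: (hu) => <- _; apply: (supported_reachD (k := 0) _ hu); lia.
exact: (supported_reachD _ hu).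
Qed.

Lemma pexp_sum_step (psi : D -> D -> R) c n x :
  (forall x, \sum_(y <- supp x) p x y * psi x y = c) ->
  pexp p supp n x (fun u => \sum_(0 <= k < n) psi (u k) (u k.+1)) = n%:R * c.
Proof.
move=> hc; elim: n x => [|n IH] x; first by rewrite /= big_geq// mul0r.
rewrite /=; under eq_bigr => y _.
  under eq_pexp => u [u0 _] do rewrite big_nat_recl//= u0.
  rewrite pexpD (pexp_cst sum1) IH mulrDr.
over.
by rewrite big_split /= hc -mulr_suml sum1 -natr1 mulrDl !mul1r addrC.
Qed.

(** Orthogonality of martingale increments: once the first step is split off, the cross term
    vanishes because the remaining sum has mean zero from every state. *)
Lemma pexp_sum_sq (psi : D -> D -> R) (B : R) n x :
  (forall x, \sum_(y <- supp x) p x y * psi x y = 0) ->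
  (forall x y, y \in supp x -> psi x y ^+ 2 <= B) ->
  pexp p supp n x (fun u => (\sum_(0 <= k < n) psi (u k) (u k.+1)) ^+ 2)
    <= n%:R * B.
Proof.
move=> h0 hB; elim: n x => [|n IH] x.
  by rewrite /= big_geq// expr0n mul0r.
rewrite /= -natr1 mulrDl mul1r addrC.
have -> : B + n%:R * B = \sum_(y <- supp x) p x y * (B + n%:R * B).
  by rewrite -mulr_suml sum1 mul1r.
rewrite big_seq [leRHS]big_seq; apply: ler_sum => y yx.
rewrite ler_wpM2l ?(ltW (chain_gt0 yx))//.
pose S (u : nat -> D) := \sum_(0 <= k < n) psi (u k) (u k.+1).
have -> : pexp p supp n y (fun u =>
    (\sum_(0 <= k < n.+1) psi (scons x u k) (scons x u k.+1)) ^+ 2) =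
  psi x y ^+ 2 + 2 * psi x y * pexp p supp n y S +
  pexp p supp n y (fun u => S u ^+ 2).
  rewrite -[psi x y ^+ 2](pexp_cst sum1 n y) -pexpZ -!pexpD.
  apply: eq_pexp => u [u0 _]; rewrite big_nat_recl//= u0 -/(S u).
  by ring.
by rewrite (pexp_sum_step n y h0) !mulr0 addr0 lerD ?hB//; exact: IH.
Qed.
Lemma supp_reach1 x y : y \in supp x -> y \in reach supp 1 x.
Proof.
move=> yx; apply: (@supported_reach _ supp 1 x (scons x (fun=> y))).
by split=> // -[].
Qed.

Lemma surprisal_sum_le n x u : supported supp n x u ->
  surprisal n x (u n) <= \sum_(0 <= k < n) surprisal 1 (u k) (u k.+1).
Proof.
move=> hu; have [u0 _] := hu.
suff H k : (k <= n)%N ->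
    surprisal k x (u k) <= \sum_(0 <= i < k) surprisal 1 (u i) (u i.+1).
  exact: H.
elim: k => [|k IH] kn; first by rewrite u0 surprisal0 big_geq.
rewrite big_nat_recr//=; apply: le_trans (lerD (IH (ltnW kn)) (lexx _)).
rewrite -addn1; apply: surprisal_subadd.
  by rewrite -u0; apply: (supported_reachD (k := 0) _ hu); lia.
by apply: (supported_reachD _ hu); lia.
Qed.

(** * Mean absolute deviation of the surprisal *)

Definition deviation (h : R) n x : R :=
  pexp p supp n x (fun u => `|surprisal n x (u n) - n%:R * h|).

(** The sum [S] of one-step surprisals dominates the [n]-step surprisal, and the gap has mean at
    most [n * (H - h)]. The centring error [n * (H - h)] doubles this term. The fluctuation [Z] of
    [S] is bounded through its variance, with [b] left free for later tuning. *)
Lemma deviation_le n x h b :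
  0 < b -> h <= entropy 1 x -> n%:R * h <= entropy n x ->
  deviation h n x <=
    2 * (n%:R * (entropy 1 x - h)) + (n%:R * ln e ^+ 2 / b + b) / 2.
Proof.
move=> b0 hH hn; pose H := entropy 1 x.
pose S (u : nat -> D) := \sum_(0 <= k < n) surprisal 1 (u k) (u k.+1).
pose Z (u : nat -> D) := \sum_(0 <= k < n) (surprisal 1 (u k) (u k.+1) - H).
have mean y : \sum_(z <- supp y) p y z * surprisal 1 y z = H.
  by rewrite -[RHS]/(entropy 1 x) (entropy_homogeneous 1 x y).
have SZ u : Z u = S u - n%:R * H.
  by rewrite /Z sumrB sumr_const_nat subn0 mulr_natl.
have E_S : pexp p supp n x S = n%:R * H by exact: pexp_sum_step.
have E_Z : pexp p supp n x (fun u => Z u ^+ 2) <= n%:R * ln e ^+ 2.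
  apply: (pexp_sum_sq (psi := fun y z => surprisal 1 y z - H)) => [y|y z zy].
    under eq_bigr do rewrite mulrBr.
    by rewrite sumrB mean -mulr_suml sum1 mul1r subrr.
  (* Both [w] and [H] lie between 0 and [- ln e], so [- ln e] bounds their difference in absolute
     value. *)
  have := surprisal_le (supp_reach1 zy); have := surprisal_ge0 1 y z.
  have := entropy_ge0 1 x; have := entropy_le 1 x; rewrite mul1r -/H.
  set w := surprisal 1 y z => *; rewrite -sqrrN -(sqrrN (ln e)).
  by nra.
have step u : supported supp n x u -> `|surprisal n x (u n) - n%:R * h| <=
    (S u - surprisal n x (u n)) + (Z u ^+ 2 / b + b) / 2 + n%:R * (H - h).
  move=> /surprisal_sum_le; rewrite -/(S u) => phiS.
  have nHh : 0 <= n%:R * (H - h) by rewrite mulr_ge0// subr_ge0.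
  (* AM-GM: |Z| <= (Z^2 / b + b) / 2 *)
  have absZ : `|Z u| <= (Z u ^+ 2 / b + b) / 2.
    rewrite ler_pdivlMr// -(ler_pM2r b0) mulrDl divfK ?gt_eqF//.
    rewrite -[Z u ^+ 2]real_normK ?num_real//; have := sqr_ge0 (`|Z u| - b).
    by nra.
  have := ler_norm (Z u); have := ler_normr (- Z u) (Z u).
  rewrite SZ in absZ *; move: absZ; rewrite ler_norml => /andP[].
  by rewrite ler_norml => *; lra.
apply: (le_trans (le_pexp chain_gt0 step)).
rewrite (pexpD _ _ _ _
  (fun u => S u - surprisal n x (u n) + (Z u ^+ 2 / b + b) / 2)).
rewrite (pexpD _ _ _ _ (fun u => S u - surprisal n x (u n))).
rewrite pexpB (pexp_cst sum1) E_S.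
have -> : pexp p supp n x (fun u => (Z u ^+ 2 / b + b) / 2) =
    (pexp p supp n x (fun u => Z u ^+ 2) / b + b) / 2.
  transitivity (pexp p supp n x (fun u => (b^-1 / 2) * Z u ^+ 2 + b / 2)).
    by apply: eq_pexp => u _; field; rewrite gt_eqF.
  by rewrite pexpD pexpZ (pexp_cst sum1); field; rewrite gt_eqF.
rewrite -/(entropy n x).
have : pexp p supp n x (fun u => Z u ^+ 2) / b <= n%:R * ln e ^+ 2 / b.
  by rewrite ler_pM2r// invr_gt0.
by move=> *; rewrite -/H; lra.
Qed.

(** * Dips of the surprisal below linear growth *)

Definition dips (h lam : R) (M : nat) (u : nat -> D) : bool :=
  has (fun n => surprisal n (u 0%N) (u n) < n%:R * (h - lam)) (iota 1 M).

Lemma dips_past h lam M : past_event M (dips h lam M).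
Proof.
move=> u v uv; apply: eq_in_has => n; rewrite mem_iota => /andP[_ nM].
by rewrite !uv.
Qed.

(** Once the origin [u 0] is replaced by the fixed starting state, the event depends only on
    positions relative to that state. *)
Lemma dips_homogeneous h lam M x y :
  pexp p supp M x (fun u => (dips h lam M u)%:R) =
  pexp p supp M y (fun u => (dips h lam M u)%:R).
Proof.
rewrite (pexp_start _ _ _ _ (fun a u => (has (fun n => surprisal n a (u n) <
  n%:R * (h - lam)) (iota 1 M))%:R)).
rewrite (pexp_start _ _ _ y (fun a u => (has (fun n => surprisal n a (u n) <
  n%:R * (h - lam)) (iota 1 M))%:R)).
apply: pexp_homogeneous => u u' uu'; congr ((nat_of_bool _)%:R).
by apply: eq_has => n; rewrite (surprisal_isotropic _ (uu' n)).
Qed.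

Lemma dips_count h lam L M x : 0 <= lam ->
  (forall n, n%:R * h <= entropy n x) ->
  lam * (L%:R * pexp p supp M x (fun u => (dips h lam M u)%:R)) <=
  (L + M)%:R * (deviation h 1 x + entropy 1 x - h).
Proof.
(* The horizon exceeds [L] by [M] so that every window opened before [L] closes by time [K]. *)
move=> lam0 hent; set K := (L + M)%N.
pose bad u k := dips h lam M (fun i => u (k + i)%N).
pose g u k := surprisal (K - k) (u k) (u K).
(* [psi] majorises [a] plus the decrement of [g] and, unlike [a], involves one step only, so its
   mean is computable. *)
pose psi x y := `|h - surprisal 1 x y| + surprisal 1 x y.
pose a u k := Num.max 0 (h - (g u k - g u k.+1)).
have E_bad : pexp p supp K x (fun u => \sum_(0 <= k < L) (bad u k)%:R) =
    L%:R * pexp p supp M x (fun u => (dips h lam M u)%:R).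
  have H L' : (L' <= L)%N ->
      pexp p supp K x (fun u => \sum_(0 <= k < L') (bad u k)%:R) =
      L'%:R * pexp p supp M x (fun u => (dips h lam M u)%:R).
    elim: L' => [_|L' IH LL].
      under eq_pexp do rewrite big_geq//.
      by rewrite (pexp_cst sum1) mul0r.
    under eq_pexp do rewrite big_nat_recr//=.
    rewrite pexpD IH ?(ltnW LL)// -[in RHS]natr1 mulrDl mul1r; congr (_ + _).
    apply: (@pexp_window L' M K x (fun v => (dips h lam M v)%:R)).
    - by rewrite leq_add2r ltnW.
    - by move=> u v uv; rewrite (dips_past _ _ uv).
    - by move=> y; exact: dips_homogeneous.
  exact: H.
rewrite -E_bad -pexpZ.
apply: (@le_trans _ _ (pexp p supp K x (fun u =>
    \sum_(0 <= k < K) psi (u k) (u k.+1) - surprisal K x (u K)))); last first.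
  rewrite pexpB (pexp_sum_step (c := deviation h 1 x + entropy 1 x)).
    by rewrite -/(entropy K x); have := hent K; lra.
  move=> y; rewrite (entropy_homogeneous 1 x y).
  have -> : deviation h 1 x = deviation h 1 y.
    apply: pexp_homogeneous => u u' uu'.
    by rewrite (surprisal_isotropic _ (uu' 1%N)).
  rewrite /deviation /entropy /= -big_split /=; apply: eq_bigr => z _.
  by rewrite -mulrDr mul1r distrC.
apply: (le_pexp chain_gt0) => u hu; have [u0 _] := hu.
have g_sub k l : (k + l <= K)%N ->
    g u k <= surprisal l (u k) (u (k + l)%N) + g u (k + l)%N.
  move=> klK; rewrite /g; have -> : (K - k = l + (K - (k + l)))%N by lia.
  have := @surprisal_subadd l (K - (k + l)) (u k) (u (k + l)%N) (u K).
  apply; first exact: (supported_reachD klK hu).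
  have KE : (K = (k + l) + (K - (k + l)))%N by lia.
  by rewrite {1}KE; apply: (supported_reachD _ hu); rewrite -KE.
have gK : g u K = 0 by rewrite /g subnn surprisal0.
have gtel k l : (k <= l)%N ->
    \sum_(k <= j < l) (g u j - g u j.+1) = g u k - g u l.
  move=> kl; rewrite -[RHS]opprB -(telescope_sumr _ kl) -sumrN.
  by apply: eq_bigr => j _; rewrite opprB.
apply: (@le_trans _ _ (\sum_(0 <= k < K) a u k)).
  (* By [g_sub], a dip over [n] steps forces [g] to fall by less than [n * (h - lam)], so the terms
     [h - (g j - g j.+1)] of the window sum to more than [n * lam]. *)
  apply: covering_sum => // [k|k kL /hasP[n]]; first by rewrite le_max lexx.
  rewrite mem_iota add1n ltnS addn0 => /andP[n0 nM] hn; exists n; split=> //.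
  have knK : (k + n <= K)%N by rewrite leq_add// ltnW.
  have := g_sub _ _ knK; have := gtel k (k + n)%N (leq_addr _ _).
  have : \sum_(k <= j < k + n) (h - (g u j - g u j.+1)) <=
      \sum_(k <= j < k + n) a u j.
    by apply: ler_sum => j _; rewrite le_max lexx orbT.
  rewrite sumrB sumr_const_nat addKn -mulr_natl => *; lra.
have -> : surprisal K x (u K) = \sum_(0 <= j < K) (g u j - g u j.+1).
  by rewrite gtel// gK subr0 /g subn0 u0.
rewrite -sumrB big_nat_cond [leRHS]big_nat_cond.
apply: ler_sum => k; rewrite andbT => /andP[_ kK].
(* With d the decrement of [g] and f the one-step surprisal, h - d = (h - f) + (f - d), and f - d is
   nonnegative. *)
have := g_sub k 1%N; rewrite addn1 => /(_ kK) gk; rewrite /psi.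
have := ler_norm (h - surprisal 1 (u k) (u k.+1)).
have := normr_ge0 (h - surprisal 1 (u k) (u k.+1)).
by rewrite ge_max => *; apply/andP; split; lra.
Qed.

(** Divide [dips_count] by [L] and let [L] grow: the boundary contribution of [M] disappears. *)
Lemma dips_le h lam M x : 0 <= lam ->
  (forall n, n%:R * h <= entropy n x) ->
  lam * pexp p supp M x (fun u => (dips h lam M u)%:R) <=
  deviation h 1 x + entropy 1 x - h.
Proof.
move=> lam0 hent; set P := pexp _ _ _ _ _; set eta := _ - h.
rewrite leNgt; apply/negP; rewrite -subr_gt0 => d0.
have H L : L%:R * (lam * P - eta) <= M%:R * eta.
  by have := dips_count L M lam0 hent; rewrite -/P -/eta natrD; lra.
have := archi_boundP (normr_ge0 (M%:R * eta / (lam * P - eta))).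
set L := Num.bound _ => /(le_lt_trans (ler_norm _)).
by rewrite ltr_pdivrMr// ltNge H.
Qed.

End IsotropicChain.

(** * The entropy rate and convergence to it *)

Lemma natmul_ge_eventually (R : archiRealFieldType) (c K : R) : 0 < c ->
  exists n0 : nat, forall n, (n0 <= n)%N -> K <= n%:R * c.
Proof.
move=> c0; exists (Num.bound `|K / c|) => n n0n.
rewrite -ler_pdivrMr//; apply: le_trans (ler_norm _) _.
apply: le_trans (ltW (archi_boundP (normr_ge0 _))) _.
by rewrite ler_nat.
Qed.

Section EntropyLimit.
Variables (R : realType) (D : choiceType) (W : Type).
Variables (delta : D -> D -> W) (p : D -> D -> R) (supp : D -> seq D) (e : R).
Hypothesis chain : isotropic_chain delta p supp e.

Local Notation C := (- ln e).
Local Notation phi := (surprisal p supp).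
Local Notation ent := (entropy p supp).
Local Notation dev := (deviation p supp).
Local Notation E := (pexp p supp).

Let sum1 := chain_sum1 chain.

Variable x : D.

Let C0 : 0 <= C.
Proof. by rewrite oppr_ge0 ln_le0// (chain_e_le1 chain x). Qed.

(** As in Fekete's lemma, [h] is the infimum of the entropies divided by time; convergence to it
    comes with [entropy_eventually_le]. *)
Lemma entropy_rate_exists : exists h : R, [/\ 0 <= h,
  forall n, n%:R * h <= ent n x &
  forall eps, 0 < eps -> exists2 m, (0 < m)%N & ent m x <= m%:R * (h + eps)].
Proof.
(* Division by zero yields 0, so index 0 must be kept out of the infimum. *)
pose A := [set ent n.+1 x / n.+1%:R | n in [set: nat]].
have A0 : lbound A 0.
  by move=> _ [n _ <-]; rewrite divr_ge0//; exact: (entropy_ge0 chain).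
have An : A !=set0 by exists (ent 1 x / 1%:R); exists 0%N.
have infA : has_inf A by split=> //; exists 0.
exists (inf A); split.
- exact: lb_le_inf.
- case=> [|n]; first by rewrite mul0r; exact: (entropy_ge0 chain).
  rewrite mulrC -ler_pdivlMr//; apply: ge_inf; first by exists 0.
  by exists n.
- move=> eps eps0; have [_ [n _ <-]] := inf_adherent eps0 infA.
  by rewrite ltr_pdivrMr// mulrC => /ltW; exists n.+1.
Qed.

Lemma surprisal_iter m n y z :
  surprisal (pn p supp m) (reach supp m) n y z = phi (n * m) y z.
Proof. by rewrite /surprisal (pn_sample chain). Qed.

Lemma entropy_iter m n y : (0 < m)%N ->
  entropy (pn p supp m) (reach supp m) n y = ent (n * m) y.
Proof.
move=> m0; rewrite /entropy (pexp_sample chain)//.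
by apply: eq_pexp => u _; rewrite surprisal_iter.
Qed.

Lemma deviation_iter h m n y : (0 < m)%N ->
  deviation (pn p supp m) (reach supp m) (m%:R * h) n y = dev h (n * m) y.
Proof.
move=> m0; rewrite /deviation (pexp_sample chain)//.
by apply: eq_pexp => u _; rewrite surprisal_iter natrM mulrA.
Qed.

(** Following the actual path from time [n] to time [k] costs at most [C] per step. This carries
    estimates at multiples of [m] to all times. *)
Lemma surprisal_path_le n k N u : supported supp N x u -> (n <= k <= N)%N ->
  phi k x (u k) <= phi n x (u n) + (k - n)%:R * C.
Proof.
move=> hu /andP[nk kN]; have [u0 _] := hu.
have hn : u n \in reach supp n x.
  by rewrite -u0; apply: (supported_reachD (k := 0) _ hu); lia.
have hk : u k \in reach supp (k - n) (u n).
  by have := @supported_reachD _ supp N x u n (k - n);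
    rewrite subnKC//; apply.
rewrite -{1}(subnKC nk); apply: le_trans (surprisal_subadd chain hn hk) _.
by rewrite lerD2l; exact: (surprisal_le chain).
Qed.

Lemma entropy_mul_le m j : ent (j * m) x <= j%:R * ent m x.
Proof.
elim: j => [|j IH].
  by rewrite mul0n mul0r /entropy /= surprisal0.
rewrite mulSn -natr1 mulrDl mul1r addrC.
exact: le_trans (entropy_subadd chain _ _ _) (lerD (lexx _) IH).
Qed.

Variable h : R.
Hypothesis h0 : 0 <= h.
Hypothesis hle : forall n, n%:R * h <= ent n x.
Hypothesis hinf :
  forall eps, 0 < eps -> exists2 m, (0 < m)%N & ent m x <= m%:R * (h + eps).

(** Fekete's argument: in the division of [n] by [m], the remainder contributes at most [m * C]. *)
Lemma entropy_eventually_le eps : 0 < eps ->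
  exists n0, forall n, (n0 <= n)%N -> ent n x <= n%:R * (h + eps).
Proof.
move=> eps0; have eps2 : 0 < eps / 2 by rewrite divr_gt0.
have [m m0 hm] := hinf eps2.
have [n0 hn0] := natmul_ge_eventually (m%:R * C) eps2.
exists n0 => n /hn0 {}hn0.
have nE := divn_eq n m; have nm := ltn_pmod n m0.
have H1 : ent n x <= (n %/ m)%:R * ent m x + (n %% m)%:R * C.
  rewrite {1}nE; apply: le_trans (entropy_subadd chain _ _ _) _.
  by rewrite lerD// ?entropy_mul_le// (entropy_le chain).
have H2 : (n %/ m)%:R * ent m x <= (n %/ m)%:R * m%:R * (h + eps / 2).
  by rewrite -mulrA ler_wpM2l.
have H3 : (n %% m)%:R * C <= m%:R * C by rewrite ler_wpM2r// ler_nat ltnW.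
have H4 : (n %/ m)%:R * m%:R * (h + eps / 2) <= n%:R * (h + eps / 2).
  by rewrite -natrM ler_wpM2r ?addr_ge0 ?(ltW eps2)// ler_nat leq_trunc_div.
by lra.
Qed.

(** [deviation_le] for the [m]-step chain, with rate [m * h] and step probabilities at least
    [e ^+ m]. *)
Lemma deviation_mul_le eps m j : 0 < eps -> (0 < m)%N ->
  ent m x <= m%:R * (h + eps) ->
  dev h (j * m) x <=
    (j * m)%:R * (3 * eps) + (m%:R * C ^+ 2 / eps + m%:R * eps).
Proof.
move=> eps0 m0 hm; rewrite -deviation_iter//.
(* The parameter [b] grows linearly in time, which keeps the variance term bounded in [j]; taking
   [j.+1] makes it positive even at [j = 0]. *)
have b0 : 0 < j.+1%:R * m%:R * eps :> R by rewrite !mulr_gt0// ltr0n.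
have ent1 : entropy (pn p supp m) (reach supp m) 1 x = ent m x.
  by rewrite entropy_iter// mul1n.
apply: le_trans (deviation_le (iter_chain chain m) b0 _ _) _.
- by rewrite ent1.
- by rewrite entropy_iter// mulrA -natrM.
rewrite ent1 lnXn ?(chain_e_gt0 chain)// -[ln e *+ m]mulr_natl.
have mP : 0 < m%:R :> R by rewrite ltr0n.
have H1 : j%:R * (ent m x - m%:R * h) <= j%:R * (m%:R * eps).
  by rewrite ler_wpM2l//; lra.
have H2 : j%:R * (m%:R * ln e) ^+ 2 / (j.+1%:R * m%:R * eps) <=
    m%:R * C ^+ 2 / eps.
  rewrite ler_pdivrMr// (_ : _ / eps * _ = j.+1%:R * (m%:R * ln e) ^+ 2).
    by rewrite ler_wpM2r ?sqr_ge0// ler_nat.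
  by field; rewrite gt_eqF.
have j0 : 0 <= j%:R :> R by [].
have H3 : 0 <= m%:R * C ^+ 2 / eps.
  by rewrite divr_ge0 ?mulr_ge0 ?sqr_ge0 ?(ltW eps0).
have H4 : 0 <= j%:R * (m%:R * eps) by rewrite !mulr_ge0// ltW.
have H5 : 0 < m%:R * eps by rewrite mulr_gt0.
move: H2; rewrite -natr1 natrM mulrDl mulrDl mul1r => H2.
by lra.
Qed.

(** [n] lies between two consecutive multiples of [m]: the earlier one bounds the surprisal from
    above, the later one from below. *)
Lemma deviation_interpolate m n : (0 < m)%N ->
  dev h n x <= dev h (n %/ m * m) x + dev h ((n %/ m).+1 * m) x +
    2 * (m%:R * (C + h)).
Proof.
move=> m0; set j := (n %/ m)%N; set N := (j.+1 * m)%N.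
have jn : (j * m <= n)%N by rewrite leq_trunc_div.
have nN : (n <= N)%N by rewrite ltnW// /N ltn_ceil.
have NE : N = (j * m + m)%N by rewrite /N mulSn addnC.
have past k : (k <= N)%N ->
    dev h k x = E N x (fun u => `|phi k x (u k) - k%:R * h|).
  by move=> kN; rewrite (pexp_past_le sum1 _ kN)// => u v ->.
rewrite (past n nN) (past (j * m)%N (leq_trans jn nN)) (past N (leqnn N)).
rewrite -pexpD -[2 * _](pexp_cst sum1 N x) -pexpD.
apply: (le_pexp (chain_gt0 chain)) => u hu.
have U1 : phi n x (u n) <= phi (j * m) x (u (j * m)%N) + m%:R * C.
  apply: le_trans (@surprisal_path_le (j * m) n N u hu _) _.
    by rewrite jn.
  by rewrite lerD2l ler_wpM2r// ler_nat; lia.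
have U2 : phi N x (u N) <= phi n x (u n) + m%:R * C.
  apply: le_trans (@surprisal_path_le n N N u hu _) _.
    by rewrite nN leqnn.
  by rewrite lerD2l ler_wpM2r// ler_nat; lia.
have U3 : (j * m)%:R * h <= n%:R * h by rewrite ler_wpM2r// ler_nat.
have U4 : n%:R * h <= N%:R * h by rewrite ler_wpM2r// ler_nat.
have U5 : N%:R * h = (j * m)%:R * h + m%:R * h by rewrite NE natrD mulrDl.
have U6 : 0 <= m%:R * C by rewrite mulr_ge0.
have := ler_norm (phi (j * m) x (u (j * m)%N) - (j * m)%:R * h).
have := normr_ge0 (phi (j * m) x (u (j * m)%N) - (j * m)%:R * h).
have := normr_ge0 (phi N x (u N) - N%:R * h).
have := ler_norm (- (phi N x (u N) - N%:R * h)); rewrite normrN.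
by move=> *; rewrite ler_norml; apply/andP; split; lra.
Qed.

Lemma deviation_eventually_le eps : 0 < eps ->
  exists n0, forall n, (n0 <= n)%N -> dev h n x <= n%:R * eps.
Proof.
(* Each of the two multiples contributes about [3 * d * n], a quarter of [n * eps]; the other half
   absorbs the constants. *)
move=> eps0; pose d := eps / 12; have d0 : 0 < d by rewrite divr_gt0.
have [m m0 hm] := hinf d0.
pose K := m%:R * C ^+ 2 / d + m%:R * d.
have eps2 : 0 < eps / 2 by rewrite divr_gt0.
have [n0 hn0] := natmul_ge_eventually
  (m%:R * (3 * d) + 2 * K + 2 * (m%:R * (C + h))) eps2.
exists n0 => n /hn0 {}hn0.
apply: le_trans (deviation_interpolate n m0) _.
have := deviation_mul_le (n %/ m) d0 m0 hm.
have := deviation_mul_le (n %/ m).+1 d0 m0 hm.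
rewrite -/K mulSn natrD mulrDl.
have : (n %/ m * m)%:R * (3 * d) <= n%:R * (3 * d).
  by rewrite ler_wpM2r ?ler_nat ?leq_trunc_div//; lra.
have -> : n%:R * (3 * d) = n%:R * eps / 4 by rewrite /d; field.
by move=> *; lra.
Qed.

(** [n0] does not depend on [M], which later permits [M] to tend to infinity. Half of [lam] is the
    dip threshold per unit time for the [m]-step chain; the other half pays for moving a dip to the
    next multiple of [m]. *)
Lemma surprisal_rarely_small lam eta : 0 < lam -> 0 < eta ->
  exists n0, forall M, E (n0 + M) x (fun u =>
    (has (fun n => phi n x (u n) < n%:R * (h - lam)) (iota n0 M))%:R) <= eta.
Proof.
(* [dips_le] will bound [m * (lam / 2) * P] by [2 * m * eps], which equals [m * (lam / 2) * eta]. *)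
move=> lam0 eta0; pose eps := eta * lam / 4.
have eps0 : 0 < eps by rewrite divr_gt0// mulr_gt0.
have [n1 hn1] := deviation_eventually_le eps0.
have [n2 hn2] := entropy_eventually_le eps0.
pose m := (maxn n1 n2).+1; have m0 : (0 < m)%N by [].
have devm : dev h m x <= m%:R * eps by apply: hn1; rewrite /m; lia.
have entm : ent m x <= m%:R * (h + eps) by apply: hn2; rewrite /m; lia.
have lam2 : 0 < lam / 2 by rewrite divr_gt0.
have [n0 hn0] := natmul_ge_eventually (m%:R * (C + lam / 2)) lam2.
exists n0 => M; pose M' := (n0 + M).+1.
pose bad n (u : nat -> D) := phi n x (u n) < n%:R * (h - lam).
have -> : E (n0 + M) x (fun u => (has (bad^~ u) (iota n0 M))%:R) =
    E (M' * m) x (fun u => (has (bad^~ u) (iota n0 M))%:R).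
  apply/esym/(pexp_past_le sum1); first by rewrite /M'; nia.
  move=> u v uv; congr ((nat_of_bool _)%:R); apply: eq_in_has => n.
  by rewrite mem_iota => /andP[_ /ltnW /uv]; rewrite /bad => ->.
have lamm : 0 <= m%:R * (lam / 2) by rewrite mulr_ge0// ltW.
have hle' n : n%:R * (m%:R * h) <= entropy (pn p supp m) (reach supp m) n x.
  by rewrite entropy_iter// mulrA -natrM.
have := dips_le (iter_chain chain m) M' lamm hle'.
have -> : deviation (pn p supp m) (reach supp m) (m%:R * h) 1 x = dev h m x.
  by rewrite deviation_iter// mul1n.
rewrite entropy_iter// mul1n (pexp_sample chain)//; set P := pexp _ _ _ _ _.
move=> hP.
have mP : 0 < m%:R :> R by rewrite ltr0n.
apply: (@le_trans _ _ P).
  apply: (le_pexp (chain_gt0 chain)) => u hu; rewrite ler_nat.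
  case: hasP => //= -[n]; rewrite mem_iota => /andP[n0n nM] badn.
  suff -> : dips (pn p supp m) (reach supp m) (m%:R * h) (m%:R * (lam / 2)) M'
    (fun k => u (k * m)%N) by [].
  (* [n' * m] is the first multiple of [m] strictly after [n]. *)
  have [u0 _] := hu; pose n' := (n %/ m).+1.
  have nn' : (n < n' * m)%N by rewrite ltn_ceil.
  have n'n : (n' * m <= n + m)%N.
    by rewrite /n' mulSn addnC leq_add2r leq_trunc_div.
  apply/hasP; exists n'.
    rewrite mem_iota /n' /= add1n !ltnS /M'.
    by apply: leq_trans (leq_div _ _) _; lia.
  rewrite mul0n u0 surprisal_iter.
  have : phi (n' * m) x (u (n' * m)%N) <= phi n x (u n) + (n' * m - n)%:R * C.
    apply: surprisal_path_le hu _; rewrite (ltnW nn') /= leq_mul2r.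
    apply/orP; right; rewrite /n' /M' ltnS.
    by apply: leq_trans (leq_div _ _) _; lia.
  have : (n' * m - n)%:R * C <= m%:R * C by rewrite ler_wpM2r// ler_nat; lia.
  have := hn0 _ n0n; move: badn; rewrite /bad.
  have Q1 : n%:R * h <= (n' * m)%:R * h by rewrite ler_wpM2r// ler_nat ltnW.
  have Q2 : (n' * m)%:R * (lam / 2) <= n%:R * (lam / 2) + m%:R * (lam / 2).
    by rewrite -mulrDl -natrD ler_wpM2r ?ler_nat// ltW.
  have -> : n'%:R * (m%:R * h - m%:R * (lam / 2)) =
      (n' * m)%:R * h - (n' * m)%:R * (lam / 2).
    by rewrite natrM; ring.
  by move=> *; lra.
have : m%:R * (lam / 2) * P <= m%:R * (lam / 2) * eta.
  apply: le_trans hP _.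
  have -> : m%:R * (lam / 2) * eta = m%:R * (2 * eps) by rewrite /eps; field.
  by lra.
by rewrite ler_pM2l// mulr_gt0.
Qed.

End EntropyLimit.

(** * Word length in the Coxeter group *)

Section CoxeterLength.
Variables (N : nat) (W : groupType) (s : 'I_N -> W).
Local Notation len := (cox_length s).

Lemma word_value_cat u v :
  word_value s (u ++ v) = (word_value s u * word_value s v)%g.
Proof. by elim: u => [|i u IH] /=; rewrite ?mul1g// IH mulgA. Qed.

Variable k : 'I_N -> nat.
Hypothesis pres : presented_by s k.

Lemma gen_mulK i : (s i * s i)%g = 1%g.
Proof.
have /(presented_relations pres) /= := word_congr_relator [::] [::]
  (relator_involution k i).
by rewrite mulg1.
Qed.

Lemma gen_inv i : (s i)^-1%g = s i.
Proof. by apply: (mulgI (s i)); rewrite mulgV gen_mulK. Qed.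

Lemma mulg_genK i w : (w * s i * s i)%g = w.
Proof. by rewrite -mulgA gen_mulK mulg1. Qed.

Lemma gen_mulgK i w : (s i * (s i * w))%g = w.
Proof. by rewrite mulgA gen_mulK mul1g. Qed.

(** The sign character: all relators have even length. *)
Lemma word_parity u v : word_value s u = word_value s v ->
  odd (size u) = odd (size v).
Proof.
move/(presented_relations pres); elim=> //= [{}u {}v w _ -> _ ->//|{}u r {}v].
case=> [i|i]; rewrite !size_cat !oddD //=.
suff -> : odd (size (flatten (nseq (k i) [:: i; ordS i]))) = false by [].
by elim: (k i) => //= n ->.
Qed.

Lemma word_value_rev u : word_value s (rev u) = (word_value s u)^-1%g.
Proof.
elim: u => [|i u IH]; first by rewrite /= invg1.
by rewrite rev_cons -cats1 word_value_cat IH /= mulg1 invMg gen_inv.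
Qed.

(** The default value in [cox_length] is never taken, since every element is the value of some
    word. *)
Lemma cox_length_spec w : word_of_size s w (len w) /\
  forall m, word_of_size s w m -> (len w <= m)%N.
Proof.
rewrite /cox_length; case: xgetP => [n _ //|none].
have [u uw] := presented_generation pres w.
have ex : exists n, `[< word_of_size s w n >].
  by exists (size u); apply/asboolP; exists u.
case: (ex_minnP ex) => n /asboolP hn hmin; case: (none n); split=> // m hm.
exact/hmin/asboolP.
Qed.

Lemma cox_length_le u : (len (word_value s u) <= size u)%N.
Proof. by apply: (cox_length_spec _).2; exists u. Qed.

Lemma cox_length_word w : exists2 u, size u = len w & word_value s u = w.
Proof. exact: (cox_length_spec w).1. Qed.

Lemma cox_length_parity u : odd (len (word_value s u)) = odd (size u).
Proof.
by have [v <- /word_parity] := cox_length_word (word_value s u).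
Qed.

Lemma cox_length_eq0 w : len w = 0%N -> w = 1%g.
Proof.
by move=> w0; have [u] := cox_length_word w; rewrite w0 => /size0nil-> <-.
Qed.

Lemma cox_lengthV w : len w^-1%g = len w.
Proof.
suff H v : (len v^-1%g <= len v)%N.
  by apply/eqP; rewrite eqn_leq H -{1}[w]invgK H.
have [u su uv] := cox_length_word v.
by rewrite -su -uv -word_value_rev -[size u]size_rev cox_length_le.
Qed.

(** A letter changes the length by at most one, and parity rules out equality. *)
Lemma cox_length_mulr w i :
  len (w * s i)%g = (len w).+1 \/ len w = (len (w * s i)%g).+1.
Proof.
have le v : (len (v * s i)%g <= (len v).+1)%N.
  have [u <- <-] := cox_length_word v.
  rewrite -[s i]mulg1 -[(s i * 1)%g]/(word_value s [:: i]) -word_value_cat.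
  by apply: leq_trans (cox_length_le _) _; rewrite size_cat addn1.
have le1 := le w; have := le (w * s i)%g; rewrite mulg_genK => le2.
have [u _ uw] := cox_length_word w.
have : odd (len (w * s i)%g) != odd (len w).
  rewrite -uw -[s i]mulg1 -[(s i * 1)%g]/(word_value s [:: i]) -word_value_cat.
  by rewrite !cox_length_parity size_cat oddD; case: odd.
by move/eqP => neq; move: le1 le2; lia.
Qed.

Lemma cox_length_mull w i :
  len (s i * w)%g = (len w).+1 \/ len w = (len (s i * w)%g).+1.
Proof.
by rewrite -(cox_lengthV (s i * w)%g) -(cox_lengthV w) invMg gen_inv;
  exact: cox_length_mulr.
Qed.

Lemma cox_length_pred w n : len w = n.+1 -> exists i, len (w * s i)%g = n.
Proof.
move=> wn; have [u su uw] := cox_length_word w.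
case/lastP: u su uw => [|u i]; first by rewrite wn.
rewrite size_rcons wn -cats1 word_value_cat /= mulg1 => -[su] uw; exists i.
have : (len (w * s i)%g <= n)%N by rewrite -uw mulg_genK -su cox_length_le.
by case: (cox_length_mulr w i); lia.
Qed.

Lemma gen_neq1 i : s i <> 1%g.
Proof.
move=> si; have := @word_parity [:: i] [::]; rewrite /= mulg1 si => /(_ erefl).
by [].
Qed.

End CoxeterLength.

(** * Symmetry of the Weyl distance and projections to panels *)

Section BuildingGeometry.
Variables (N : nat) (W : groupType) (s : 'I_N -> W) (k : 'I_N -> nat).
Hypothesis pres : presented_by s k.
Variables (D : choiceType) (delta : D -> D -> W).
Hypothesis bld : building s delta.
Local Notation len := (cox_length s).

Lemma delta_refl x : delta x x = 1%g.
Proof. exact/(building_B1 bld). Qed.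

Lemma delta_gen_sym x y i : delta x y = s i -> delta y x = s i.
Proof.
move=> xy; have [] := building_B2 bld y xy; rewrite delta_refl.
case=> [/esym/(building_B1 bld) yx|yx _].
  by case: (gen_neq1 pres (i := i)); rewrite -xy yx delta_refl.
by apply: (mulIg (s i)); rewrite -yx (gen_mulK pres).
Qed.

(** (B2) moves only the second chamber. Induction removes the last letter of [delta z x], so (B2)
    acts at the end [x] while [s i] is prefixed at the other end. *)
Lemma delta_extend_left n x y z i : delta y z = s i -> len (delta z x) = n ->
  len (s i * delta z x)%g = n.+1 -> delta y x = (s i * delta z x)%g.
Proof.
elim: n x => [|n IH] x yz zx.
  have /(building_B1 bld) <- := cox_length_eq0 pres zx.
  by rewrite delta_refl mulg1.
have [j wj] := cox_length_pred pres zx => siw.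
have [x' [xx' zx']] := building_B3 bld z x j.
have zx'n : len (delta z x') = n by rewrite zx'.
have len_sj : len (s i * delta z x' * s j)%g = n.+2.
  by rewrite zx' -!mulgA (gen_mulK pres) mulg1.
(* Each of the two letters raises the length by at most one, and together they raise it from [n] to
   [n.+2]. *)
have six' : len (s i * delta z x')%g = n.+1.
  move: len_sj; have := cox_length_mulr pres (s i * delta z x')%g j.
  by have := cox_length_mull pres (delta z x') i; lia.
have [_ /(_ _)] := building_B2 bld y (delta_gen_sym xx').
rewrite (IH _ yz zx'n six') len_sj six' => -> //.
by rewrite zx' -!mulgA (gen_mulK pres) mulg1.
Qed.

Lemma delta_sym x y : delta y x = (delta x y)^-1%g.
Proof.
move E : (len (delta x y)) => n; elim: n y E => [|n IH] y xy.
  have /(building_B1 bld) <- := cox_length_eq0 pres xy.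
  by rewrite delta_refl invg1.
have [i wi] := cox_length_pred pres xy.
have [z [yz xz]] := building_B3 bld x y i.
have zx : delta z x = (delta x z)^-1%g by apply: IH; rewrite xz.
have sizx : (s i * delta z x)%g = (delta x y)^-1%g.
  by rewrite zx xz invMg (gen_inv pres) (gen_mulgK pres).
rewrite (@delta_extend_left n x y z i yz) ?sizx//.
  by rewrite zx (cox_lengthV pres) xz.
by rewrite (cox_lengthV pres).
Qed.

Lemma delta_inj_left x y x' y' : delta x y = delta x' y' ->
  delta y x = delta y' x'.
Proof. by move=> xy; rewrite delta_sym xy -delta_sym. Qed.

Lemma delta_left_step x y z i : delta x z = s i ->
  delta z y = delta x y \/ delta z y = (s i * delta x y)%g.
Proof.
move=> xz; have [+ _] := building_B2 bld y xz.
rewrite (delta_sym y z) (delta_sym y x) => -[->|->]; first by left.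
by right; rewrite invMg (gen_inv pres).
Qed.

Lemma delta_left_up x y z i : delta x z = s i ->
  len (s i * delta x y)%g = (len (delta x y)).+1 ->
  delta z y = (s i * delta x y)%g.
Proof. by move=> /delta_gen_sym xz; apply: delta_extend_left. Qed.

Lemma delta_left_exists x y i :
  exists z, delta x z = s i /\ delta z y = (s i * delta x y)%g.
Proof.
have [z [xz yz]] := building_B3 bld y x i; exists z; split=> //.
by rewrite (delta_sym y z) yz invMg (gen_inv pres) -delta_sym.
Qed.

Lemma delta_realize x w : exists y, delta x y = w.
Proof.
move E : (len w) => n; elim: n w E => [|n IH] w.
  by move/(cox_length_eq0 pres) ->; exists x; exact: delta_refl.
move=> wn; have [i /IH[y xy]] := cox_length_pred pres wn.
have [z [_ xz]] := building_B3 bld x y i.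
by exists z; rewrite xz xy (mulg_genK pres).
Qed.

(** Uniqueness of the projection of [y] to a panel: two different such chambers would be
    [s i]-adjacent, and passing from one to the other would turn [u] into the longer [s i * u]. *)
Lemma delta_descent_unique x y z z' i u :
  delta x z = s i -> delta x z' = s i -> delta z y = u -> delta z' y = u ->
  len (s i * u)%g = (len u).+1 -> z = z'.
Proof.
move=> xz xz' zy z'y siu.
have [+ _] := building_B2 bld z xz'.
rewrite (delta_gen_sym xz) (gen_mulK pres) => -[zz'|/(building_B1 bld)//].
have := delta_left_up (y := y) zz'; rewrite zy z'y => /(_ siu) uE.
by case: (gen_neq1 pres (i := i)); apply: (mulIg u); rewrite -uE mul1g.
Qed.

Hypothesis reg : regular_building s delta.

Lemma finite_ball x n : finite_set [set y | (len (delta x y) <= n)%N].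
Proof.
have [q hq] := reg.
elim: n => [|n IH].
  apply: (sub_finite_set _ (finite_set1 x)) => y /=; rewrite leqn0 => /eqP.
  by move=> /(cox_length_eq0 pres)/(building_B1 bld) ->.
pose B := \bigcup_(y in [set y | (len (delta x y) <= n)%N])
  \bigcup_(i in [set: 'I_N]) [set z | delta y z = s i].
apply: (@sub_finite_set _ _ ([set y | (len (delta x y) <= n)%N] `|` B)).
  move=> y /=; rewrite leq_eqVlt => /predU1P[xy|]; last by rewrite ltnS; left.
  right; have [i xyi] := cox_length_pred pres xy.
  have [z [yz xz]] := building_B3 bld x y i.
  exists z; first by rewrite /= xz xyi.
  by exists i => //=; exact: delta_gen_sym.
rewrite finite_setU; split=> //; apply: bigcup_finite => // y _.
apply: bigcup_finite => // i _; exists (q i); exact: hq.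
Qed.

Lemma finite_sphere x w : finite_set [set y | delta x y = w].
Proof.
by apply: sub_finite_set (finite_ball x (len w)) => y /= ->.
Qed.

Definition sphere (w : W) (x : D) : seq D :=
  enum_fset (fset_set [set y | delta x y = w]).

Lemma mem_sphere w x y : (y \in sphere w x) = (delta x y == w).
Proof.
rewrite /sphere in_fset_set; last exact: finite_sphere.
apply/idP/eqP => [/set_mem //|xy]; exact/mem_set.
Qed.

Lemma sphere_uniq w x : uniq (sphere w x).
Proof. exact: fset_uniq. Qed.

Lemma size_sphere_gen i x y : size (sphere (s i) x) = size (sphere (s i) y).
Proof.
have [q hq] := reg.
have H z : size (sphere (s i) z) = q i.
  by have /card_fset_set := hq i z; rewrite cardfE.
by rewrite !H.
Qed.

Lemma sum_same_values (R : nmodType) (r r' : seq D) (g g' : D -> R) :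
  size r = size r' ->
  (forall z z', z \in r -> z' \in r' -> g z = g' z') ->
  \sum_(z <- r) g z = \sum_(z <- r') g' z.
Proof.
elim: r r' => [|z r IH] [|z' r'] //=; first by rewrite !big_nil.
move=> [srr'] gg'.
rewrite !big_cons (gg' z z') ?mem_head// (IH r')// => t t' tr tr'.
by apply: gg'; rewrite inE ?tr ?tr' orbT.
Qed.

(** * Structure constants of a regular building *)

Section SphereSums.
Variable R : nmodType.
Implicit Types g : D -> R.

(** If [s i] lengthens [delta y x], all [s i]-neighbours of [y] sit at the same distance from [x].
    Otherwise exactly one is nearer and the others keep the distance of [y]. Regularity makes the
    counts agree. *)
Lemma sphere_gen_sum i x y x' y' g g' : delta y x = delta y' x' ->
  (forall z z', delta y z = s i -> delta y' z' = s i ->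
    delta z x = delta z' x' -> g z = g' z') ->
  \sum_(z <- sphere (s i) y) g z = \sum_(z <- sphere (s i) y') g' z.
Proof.
move=> yx gg'; have sz := size_sphere_gen i y y'.
case: (cox_length_mull pres (delta y x) i) => [up|down].
  apply: sum_same_values => // z z'; rewrite !mem_sphere => /eqP yz /eqP yz'.
  by apply: gg' => //; rewrite (delta_left_up yz)// (delta_left_up yz') -yx.
have [z0 [yz0 z0x]] := delta_left_exists y x i.
have [z0' [yz0' z0x']] := delta_left_exists y' x' i.
have in0 : z0 \in sphere (s i) y by rewrite mem_sphere yz0.
have in0' : z0' \in sphere (s i) y' by rewrite mem_sphere yz0'.
rewrite (perm_big _ (perm_to_rem in0)) (perm_big _ (perm_to_rem in0')).
rewrite !big_cons.
congr (_ + _); first by apply: gg'; rewrite // z0x z0x' yx.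
have others (a b c z : D) : delta a b = delta y x -> delta a c = s i ->
    delta c b = (s i * delta y x)%g ->
    z \in rem c (sphere (s i) a) -> delta a z = s i /\ delta z b = delta y x.
  move=> ab ac cb; rewrite rem_filter ?sphere_uniq// mem_filter /= mem_sphere.
  move=> /andP[/eqP zc /eqP az]; split=> //.
  have [->//|zb] := delta_left_step b az.
  case: zc; apply: (delta_descent_unique az ac zb).
    by rewrite ab.
  by rewrite ab (gen_mulgK pres).
apply: sum_same_values; first by rewrite !size_rem// sz.
move=> z z' /(others _ _ _ _ erefl yz0 z0x)[yz zx].
rewrite -yx in z0x'; move=> /(others _ _ _ _ (esym yx) yz0' z0x')[yz' zx'].
by apply: gg'; rewrite // zx.
Qed.

Lemma big_fibers (I J : eqType) (r : seq I) (t : seq J) (f : I -> J)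
    (F : I -> R) : uniq t -> (forall i, i \in r -> f i \in t) ->
  \sum_(i <- r) F i = \sum_(j <- t) \sum_(i <- r | f i == j) F i.
Proof.
move=> tu ft; rewrite (exchange_big_dep xpredT)//= big_seq [RHS]big_seq.
apply: eq_bigr => i /ft fit.
rewrite big_mkcond (bigD1_seq (f i))//= eqxx big1 ?addr0// => j.
by rewrite eq_sym => /negPf ->.
Qed.

(** Encodes that the number of [z] with given [delta y z] and [delta z x] depends only on
    [delta y x]. Induction on the length of [u]: a sphere of type [s i * v] is the disjoint union of
    the [v]-spheres around the [s i]-neighbours. *)
Lemma sphere_sum u x y x' y' g g' : delta y x = delta y' x' ->
  (forall z z', delta y z = u -> delta y' z' = u ->
    delta z x = delta z' x' -> g z = g' z') ->
  \sum_(z <- sphere u y) g z = \sum_(z <- sphere u y') g' z.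
Proof.
move E : (len u) => n; elim: n u E y y' g g' => [|n IH] u un y y' g g' yx gg'.
  have u1 := cox_length_eq0 pres un; rewrite u1 in gg' *.
  have H a : perm_eq (sphere 1%g a) [:: a].
    apply: uniq_perm => // [|b]; first exact: sphere_uniq.
    rewrite mem_sphere mem_seq1 eq_sym; apply/eqP/eqP => [/esym|->].
      by move/(building_B1 bld).
    by rewrite delta_refl.
  by rewrite !(perm_big _ (H _)) !big_seq1; apply: gg' => //; exact: delta_refl.
have [i ui] : exists i, len (s i * u)%g = n.
  have [|i hi] := cox_length_pred pres (w := u^-1%g) (n := n).
    by rewrite (cox_lengthV pres).
  by exists i; rewrite -(cox_lengthV pres) invMg (gen_inv pres).
pose v := (s i * u)%g.
have uE : u = (s i * v)%g by rewrite (gen_mulgK pres).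
have split_sum a (f : D -> R) : \sum_(z <- sphere u a) f z =
    \sum_(b <- sphere (s i) a) \sum_(z <- sphere v b) f z.
  have ex z : z \in sphere u a -> exists b, delta a b = s i /\ delta b z = v.
    rewrite mem_sphere => /eqP az; have [b [ab bz]] := delta_left_exists a z i.
    by exists b; rewrite bz az.
  (* [h z] is the first chamber after [a] on a gallery to [z] starting with type [i]; by
     [delta_descent_unique] the fibre over [b] is the whole [v]-sphere of [b]. *)
  pose h z := xget a [set b | delta a b = s i /\ delta b z = v].
  have hP z : z \in sphere u a -> delta a (h z) = s i /\ delta (h z) z = v.
    by move=> /ex[b hb]; rewrite /h; case: xgetP => [c _ //|/(_ b)].
  rewrite (@big_fibers _ _ _ (sphere (s i) a) h) ?sphere_uniq//; last first.
    by move=> z /hP[az _]; rewrite mem_sphere az.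
  rewrite big_seq [RHS]big_seq; apply: eq_bigr => b.
  rewrite mem_sphere => /eqP ab.
  rewrite -big_filter; apply: perm_big; apply: uniq_perm.
  - by rewrite filter_uniq// sphere_uniq.
  - exact: sphere_uniq.
  move=> z; rewrite mem_filter [in RHS]mem_sphere.
  apply/andP/eqP => [[/eqP <- /hP[]]//|bz].
  have zu : z \in sphere u a.
    rewrite mem_sphere uE -bz; apply/eqP.
    apply: (delta_left_up (delta_gen_sym ab)).
    by rewrite bz -uE un ui.
  split=> //; have [ah hz] := hP z zu.
  apply/eqP/(delta_descent_unique ah ab hz bz).
  by rewrite -uE un ui.
rewrite !split_sum; apply: sphere_gen_sum yx _ => b b' ab ab' bx.
apply: IH => // z z' bz bz' zx; apply: gg' => //.
  rewrite uE -bz; apply: (delta_left_up (delta_gen_sym ab)).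
  by rewrite bz -uE un ui.
rewrite uE -bz'; apply: (delta_left_up (delta_gen_sym ab')).
by rewrite bz' -uE un ui.
Qed.

End SphereSums.

(** * From the isotropic walk to the abstract chain *)

Section WalkSupport.
Variables (R : realType) (p : D -> D -> R).
Hypothesis tm : transition_matrix p.
Hypothesis iso : isotropic delta p.
Hypothesis bounded : bounded_range s delta p.

Definition steps (x : D) : seq D := enum_fset (fset_set [set y | 0 < p x y]).

Lemma mem_steps x y : (y \in steps x) = (0 < p x y).
Proof.
have [L0 hL0] := bounded.
rewrite /steps in_fset_set.
  by apply/idP/idP => [/set_mem //|xy]; exact/mem_set.
by apply: sub_finite_set (finite_ball x L0) => z; exact: hL0.
Qed.

Lemma steps_uniq x : uniq (steps x).
Proof. exact: fset_uniq. Qed.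

Lemma steps_sum1 x : \sum_(y <- steps x) p x y = 1.
Proof.
have [p0 /(_ x) p1] := tm; have [L0 hL0] := bounded.
apply: EFin_inj; rewrite -[RHS]p1 -sumEFin.
have fin : finite_set [set y | 0 < p x y].
  by apply: sub_finite_set (finite_ball x L0) => z; exact: hL0.
transitivity (\esum_(y in [set y | (0 < p x y)%R]) (p x y)%:E)%E.
  by rewrite esum_fset// => [|y _]; rewrite ?fsbig_finite// lee_fin.
rewrite esum_mkcond; apply: eq_esum => y _.
case: ifPn => //; rewrite notin_setE /= => /negP; rewrite -leNgt => py.
by congr EFin; apply/eqP; rewrite eq_le py p0.
Qed.

Lemma steps_lumpable : lumpable (fun x y => delta y x) p steps.
Proof.
move=> x y x' y' g g' yx gg'.
(* One list of distances serves both [y] and [y']; by isotropy a sphere with one charged chamber is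
   charged entirely. *)
pose us := undup (map (delta y) (steps y) ++ map (delta y') (steps y')).
have inner a (f : D -> R) u : u \in us ->
    \sum_(z <- steps a | delta a z == u) f z = \sum_(z <- sphere u a) f z.
  move=> uus; rewrite -big_filter; apply: perm_big; apply: uniq_perm.
  - by rewrite filter_uniq// steps_uniq.
  - exact: sphere_uniq.
  move=> z; rewrite mem_filter mem_sphere mem_steps; case: eqP => //= az.
  have [b [c [bc pbc]]] : exists b c, delta b c = u /\ 0 < p b c.
    move: uus; rewrite mem_undup mem_cat => /orP[] /mapP[c];
      rewrite mem_steps => pc ->.
      by exists y, c.
    by exists y', c.
  by rewrite -(@iso b c a z) ?bc.
rewrite (@big_fibers _ _ _ _ us (delta y)) ?undup_uniq//; last first.
  by move=> z zy; rewrite mem_undup mem_cat map_f.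
rewrite [RHS](@big_fibers _ _ _ _ us (delta y')) ?undup_uniq//; last first.
  by move=> z zy; rewrite mem_undup mem_cat map_f ?orbT.
rewrite big_seq [RHS]big_seq; apply: eq_bigr => u uus; rewrite !inner//.
apply: sphere_sum yx _ => z z' yz yz' zx.
by rewrite (@iso y z y' z') ?yz// (gg' z z').
Qed.

(** Every Weyl distance is realised from [o], so the finitely many positive values of [p o] are all
    the positive values of [p]. *)
Lemma steps_min (o : D) :
  exists2 e, 0 < e & forall x y, 0 < p x y -> e <= p x y.
Proof.
have [e e0 he] : exists2 e, 0 < e & forall y, y \in steps o -> e <= p o y.
  have : forall y, y \in steps o -> 0 < p o y by move=> y; rewrite mem_steps.
  elim: (steps o) => [|y r IH] pos; first by exists 1.
  have [|e e0 he] := IH; first by move=> z zr; apply: pos; rewrite inE zr orbT.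
  exists (Num.min e (p o y)); first by rewrite lt_min e0 pos ?mem_head.
  move=> z; rewrite inE => /predU1P[->|/he ez]; rewrite ge_min ?lexx ?orbT//.
  by rewrite ez.
exists e => // x y xy; have [z oz] := delta_realize o (delta x y).
by rewrite -(iso oz); apply: he; rewrite mem_steps (iso oz).
Qed.

Lemma isotropic_walk_chain (o : D) :
  exists e, isotropic_chain delta p steps e.
Proof.
have [e e0 he] := steps_min o; exists e; split=> //.
- exact: steps_uniq.
- by move=> x y; rewrite mem_steps; exact: he.
- exact: steps_sum1.
- by move=> x y; rewrite !delta_refl.
- move=> x y x' y' xy /(building_B1 bld); rewrite xy.
  by move/(building_B1 bld).
- move=> x y x' y' g g' xy gg'.
  (* Inversion of Weyl distances turns the forward condition into the backward one. *)
  apply: (@steps_lumpable x y x' y'); first exact: delta_inj_left.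
  by move=> z z' zx; apply: gg'; exact: delta_inj_left.
- exact: steps_lumpable.
Qed.

End WalkSupport.

End BuildingGeometry.

(** * Identification of the law of the process with [pexp] *)

Section MarkovLaw.
Variables (R : realType) (D : choiceType) (p : D -> D -> R) (supp : D -> seq D).
Hypothesis supp_uniq : forall x, uniq (supp x).
Hypothesis p_sum1 : forall x, \sum_(y <- supp x) p x y = 1.
Context {d : measure_display} {T : measurableType d}.
Variables (P : probability T R) (o : D) (X : nat -> T -> D).
Hypothesis hX : markov_chain P p o X.

Let mX n (A : set D) : measurable (X n @^-1` A) := markov_measurable hX n A.

Definition cylinder n (x : nat -> D) : set T :=
  [set t | forall i, (i <= n)%N -> X i t = x i].

Lemma cylinderS n x y :
  cylinder n x `&` X n.+1 @^-1` [set y] =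
  cylinder n.+1 (fun i => if (i <= n)%N then x i else y).
Proof.
apply/seteqP; split=> t.
  move=> [xt /= yt] i; rewrite leq_eqVlt => /predU1P[->|].
    by rewrite ltnn.
  by rewrite ltnS => ile; rewrite ile xt.
move=> xt; split=> [i ile|]; first by rewrite xt ?ile// leqW.
by rewrite /= xt// ltnn.
Qed.

Lemma measurable_cylinder n x : measurable (cylinder n x).
Proof.
elim: n => [|n IH].
  rewrite (_ : cylinder 0 x = X 0%N @^-1` [set x 0%N])//.
  apply/seteqP; split=> t; first by move/(_ 0%N (leqnn _)).
  by move=> xt i; rewrite leqn0 => /eqP ->.
rewrite (_ : cylinder n.+1 x = cylinder n x `&` X n.+1 @^-1` [set x n.+1]).
  exact: measurableI.
have E i : (i <= n.+1)%N -> (if (i <= n)%N then x i else x n.+1) = x i.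
  by move=> ile; case: ifPn => // ni; have -> : i = n.+1 by lia.
by rewrite cylinderS; apply/seteqP; split=> t xt i ile; rewrite xt// E.
Qed.

Lemma measure_split (A : set T) n r : measurable A -> uniq r ->
  P A = (\sum_(y <- r) P (A `&` X n @^-1` [set y]) +
         P (A `&` X n @^-1` [set y | y \notin r]))%E.
Proof.
move=> mA; elim: r => [_|y r IH /= /andP[yr ur]].
  rewrite big_nil add0e (_ : [set y | _] = setT) ?preimage_setT ?setIT//.
  by apply/seteqP; split.
rewrite big_cons IH// addeAC addeC; congr (_ + _)%E.
rewrite -measureU; [|exact: measurableI..|]; last first.
  rewrite setIACA setIid -preimage_setI [X in _ @^-1` X](_ : _ = set0).
    by rewrite preimage_set0 setI0.
  by apply/seteqP; split=> z //= -[->]; rewrite mem_head.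
rewrite -setIUr -preimage_setU; congr (P (_ `&` _ @^-1` _)).
apply/seteqP; split=> z /=; rewrite inE negb_or.
  by move=> zr; have [->|zy] := eqVneq z y; [left|right].
by move=> [->|/andP[]].
Qed.

Lemma measure_cylinder_step n x y :
  P (cylinder n x `&` X n.+1 @^-1` [set y]) =
  (P (cylinder n x) * (p (x n) y)%:E)%E.
Proof.
rewrite cylinderS (markov_step hX) leqnn ltnn; congr (P _ * _)%E.
by apply/seteqP; split=> t xt i ile; have := xt i ile; rewrite ile.
Qed.

(** The one-step extensions inside [supp (x n)] already exhaust the mass of the cylinder. *)
Lemma cylinder_exit n x :
  P (cylinder n x `&` X n.+1 @^-1` [set y | y \notin supp (x n)]) = 0%E.
Proof.
have := measure_split n.+1 (measurable_cylinder n x) (supp_uniq (x n)).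
rewrite (eq_bigr (fun y => P (cylinder n x) * (p (x n) y)%:E)%E); last first.
  by move=> y _; exact: measure_cylinder_step.
have fin A : measurable A -> P A \is a fin_num.
  by move=> mA; rewrite fin_num_measure.
have mC := measurable_cylinder n x.
have mE : measurable
    (cylinder n x `&` X n.+1 @^-1` [set y | y \notin supp (x n)]).
  exact: measurableI.
move: (fin _ mC) (fin _ mE); case: (P (cylinder n x)) => // a _.
case: (P _) => // b _; rewrite sumEFin -mulr_sumr p_sum1 mulr1 -EFinD => -[].
by move=> ab; congr EFin; lra.
Qed.

(** Induction on the number [n] of times still free; the cylinder grows by one coordinate at each
    stage. *)
Lemma measure_cylinderI n m x (Q : (nat -> D) -> bool) :
  past_event (m + n) Q -> measurable [set t | Q (fun i => X i t)] ->
  P (cylinder m x `&` [set t | Q (fun i => X i t)]) =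
  (P (cylinder m x) *
   (pexp p supp n (x m) (fun v => (Q (glue m x v))%:R))%:E)%E.
Proof.
elim: n m x => [|n IH] m x pQ mQ /=.
  have QE t : cylinder m x t ->
      Q (fun i => X i t) = Q (glue m x (fun=> x m)).
    move=> xt; apply: pQ => i; rewrite addn0 => im; rewrite xt// /glue.
    by case: ltngtP im => // ->.
  case Qx : (Q (glue m x _)).
    rewrite mule1; congr (P _); apply/seteqP; split=> t; first by case.
    by move=> xt; split=> //=; rewrite QE.
  rewrite mule0 (_ : _ `&` _ = set0) ?measure0//.
  by apply/seteqP; split=> t //= -[/QE ->]; rewrite Qx.
set S := [set t | _] in mQ *.
have mC := measurable_cylinder m x.
rewrite (measure_split m.+1 (measurableI _ _ mC mQ) (supp_uniq (x m))).
rewrite (_ : P (_ `&` X m.+1 @^-1` [set y | _]) = 0%E) ?adde0; last first.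
  apply: (@subset_measure0 _ _ _ P _
    (cylinder m x `&` X m.+1 @^-1` [set y | y \notin supp (x m)])).
  - by apply: measurableI => //; exact: measurableI.
  - exact: measurableI.
  - by move=> t [[]].
  - exact: cylinder_exit.
have cE : P (cylinder m x) = (fine (P (cylinder m x)))%:E.
  by rewrite fineK// fin_num_measure.
rewrite cE -EFinM mulr_sumr -sumEFin; apply: eq_bigr => y _.
rewrite setIAC cylinderS IH ?addSnnS//.
rewrite -cylinderS measure_cylinder_step cE ltnn -!EFinM -mulrA.
congr (_ * (_ * _))%:E; apply: eq_pexp => v _; congr ((nat_of_bool (Q _))%:R).
apply/funext => i; rewrite /glue ltnS; case: (ltngtP i m) => // [im|->].
  by have -> : (i - m = (i - m.+1).+1)%N by lia.
by rewrite subnn.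
Qed.

Lemma measure_event n (Q : (nat -> D) -> bool) :
  past_event n Q -> measurable [set t | Q (fun i => X i t)] ->
  P [set t | Q (fun i => X i t)] = (pexp p supp n o (fun u => (Q u)%:R))%:E.
Proof.
move=> pQ mQ; set S := [set t | _] in mQ *.
have mC := measurable_cylinder 0 (fun=> o).
have C0 : P (~` cylinder 0 (fun=> o)) = 0%E.
  have [A [mA A0 CA]] := markov_start hX.
  apply: (subset_measure0 _ mA _ A0); first exact: measurableC.
  move=> t Ct; apply: CA => /= Xt; apply: Ct => i.
  by rewrite leqn0 => /eqP ->.
have PC A : measurable A -> P A = P (cylinder 0 (fun=> o) `&` A).
  move=> mA; rewrite (measureDI P mA mC) setIC [X in (X + _)%E](_ : _ = 0%E).
    by rewrite add0e.
  apply: (subset_measure0 _ _ _ C0); [exact: measurableD|exact: measurableC|].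
  by move=> t [].
have C1 : P (cylinder 0 (fun=> o)) = 1%E.
  by rewrite -[LHS](congr1 P (setIT _)) -PC// probability_setT.
rewrite PC// /S (@measure_cylinderI n 0 (fun=> o))// C1 mul1e.
by congr EFin; apply: eq_pexp => u _; rewrite glue0.
Qed.

Lemma measure_state n y : P (X n @^-1` [set y]) = (pn p supp n o y)%:E.
Proof.
have := @measure_event n (fun u => u n == y).
rewrite pn_pexp (_ : [set t | X n t == y] = X n @^-1` [set y]); last first.
  by apply/seteqP; split=> t /eqP.
by apply=> // u v ->.
Qed.

Lemma law_pn n y : law P X n y = pn p supp n o y.
Proof. by rewrite /law measure_state. Qed.

(** Almost surely [X n] lies in the finite list [reach supp n o], so the integrand agrees almost
    everywhere with the simple function [S]. *)
Lemma expectation_state n (g : D -> R) :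
  'E_P[fun t => g (X n t)]%E = (pexp p supp n o (fun u => g (u n)))%:E.
Proof.
pose S (t : T) := (\sum_(y <- reach supp n o)
  (g y)%:E * (\1_(X n @^-1` [set y]) t)%:E)%E.
have mXy y : measurable (X n @^-1` [set y]) by exact: mX.
have intS y :
    P.-integrable setT (fun t => (g y)%:E * (\1_(X n @^-1` [set y]) t)%:E)%E.
  by apply: integrableZl => //; exact: integrable_indic.
rewrite unlock (ae_eq_integral S) //=.
- rewrite /S integral_sum//.
  rewrite -(pn_sum p_sum1) -sumEFin; apply: eq_bigr => y _.
  rewrite integralZl//; last exact: integrable_indic.
  rewrite integral_indic// setIT EFinM muleC; congr (_ * _)%E.
  exact: measure_state.
- by move=> _ A mA; rewrite setTI; exact: (mX n ((EFin \o g) @^-1` A)).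
- apply: emeasurable_sum => y; exact: measurable_int (intS y).
exists (X n @^-1` [set y | y \notin reach supp n o]); split.
- exact: mX.
- have := @measure_event n (fun u => u n \notin reach supp n o).
  rewrite (@eq_pexp _ _ _ _ _ _ _ (fun=> 0)) ?(pexp_cst p_sum1).
    by apply=> [u v -> //|]; exact: (mX n [set y | y \notin reach supp n o]).
  by move=> u /supported_reach ->.
move=> t /= /not_implyP[_ gS]; apply/negP => Xr; apply: gS.
rewrite /S (bigD1_seq (X n t))//= ?reach_uniq// indicE mem_set//= mule1.
rewrite big1 ?adde0// => y yX; rewrite indicE memNset ?mule0//= => Xy.
by rewrite Xy eqxx in yX.
Qed.

End MarkovLaw.

(** * Almost sure lower limit and convergence in mean *)

Lemma limn_einf_eq (R : realType) (u : nat -> R) (h : R) :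
  (forall j : nat, exists n0, forall n, (n0 <= n)%N -> h - j.+1%:R^-1 <= u n) ->
  (forall j n0 : nat, exists2 n, (n0 <= n)%N & u n <= h + j.+1%:R^-1) ->
  limn_einf (fun n => (u n)%:E) = h%:E.
Proof.
move=> lower upper; have inv e : 0 < e -> exists j : nat, j.+1%:R^-1 <= e :> R.
  move=> e0; have [n0 /(_ _ (leqnSn n0)) hn] := natmul_ge_eventually 1 e0.
  by exists n0; rewrite -div1r ler_pdivrMr// mulrC.
rewrite limn_einf_lim (cvg_lim _ (@cvg_einfs_sup _ _))//.
apply/eqP; rewrite eq_le; apply/andP; split.
  apply: ge_ereal_sup => _ [n0 _ <-]; apply/lee_addgt0Pr => e e0.
  have [j je] := inv _ e0; have [n n0n un] := upper j n0.
  apply: le_trans (_ : (u n)%:E <= _)%E.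
    by apply: ereal_inf_lbound; exists n.
  by rewrite -EFinD lee_fin (le_trans un)// lerD2l.
apply/lee_addgt0Pr => e e0; have [j je] := inv _ e0; have [n0 hn0] := lower j.
rewrite -leeBlDr//; apply: (@le_trans _ _ (einfs (fun n => (u n)%:E) n0)).
  apply: le_ereal_inf_tmp => _ [n /= n0n <-].
  by rewrite -EFinB lee_fin (le_trans _ (hn0 _ n0n))// lerD2l lerN2.
by apply: ereal_sup_ubound; exists n0.
Qed.

Section EntropyTheorem.
Variables (R : realType) (D : choiceType) (W : Type).
Variables (delta : D -> D -> W) (p : D -> D -> R) (supp : D -> seq D) (e : R).
Hypothesis chain : isotropic_chain delta p supp e.
Context {d : measure_display} {T : measurableType d}.
Variables (P : probability T R) (o : D) (X : nat -> T -> D).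
Hypothesis hX : markov_chain P p o X.

Local Notation phi := (surprisal p supp).
Local Notation ent := (entropy p supp).
Local Notation dev := (deviation p supp).

Let sum1 := chain_sum1 chain.
Let supp_uniq := chain_uniq chain.
Let mX n (A : set D) : measurable (X n @^-1` A) := markov_measurable hX n A.

Lemma measure_le_eps_eq0 (A : set T) :
  (forall eps, 0 < eps -> (P A <= eps%:E)%E) -> P A = 0%E.
Proof.
move=> PA; apply/eqP; rewrite eq_le measure_ge0 andbT.
by apply/lee_addgt0Pr => eps /PA; rewrite add0e.
Qed.

(** The exceptional set lies in the union of all [small n] from [n0] on, an increasing limit of
    finite unions whose probabilities are bounded uniformly by [surprisal_rarely_small]. *)
Lemma surprisal_liminf_ge h lam : 0 <= h -> (forall n, n%:R * h <= ent n o) ->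
  (forall eps, 0 < eps ->
    exists2 m, (0 < m)%N & ent m o <= m%:R * (h + eps)) -> 0 < lam ->
  {ae P, forall t, exists n0, forall n, (n0 <= n)%N ->
    n%:R * (h - lam) <= phi n o (X n t)}.
Proof.
move=> h0 hle hinf lam0.
pose small n := X n @^-1` [set y | phi n o y < n%:R * (h - lam)].
have m_tail n0 : measurable (\bigcup_n small (n0 + n)%N).
  by apply: bigcupT_measurable => n; exact: mX.
exists (\bigcap_n0 \bigcup_n small (n0 + n)%N); split.
- exact: bigcapT_measurable.
- apply: measure_le_eps_eq0 => eps eps0.
  have [n0 hn0] := surprisal_rarely_small chain h0 hle hinf lam0 eps0.
  apply: (@le_trans _ _ (P (\bigcup_n small (n0 + n)%N))).
    apply: le_measure; [exact/mem_set/bigcapT_measurable|exact/mem_set|].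
    by move=> t; apply.
  pose F M := \bigcup_(n in `I_M) small (n0 + n)%N.
  have FE : \bigcup_n small (n0 + n)%N = \bigcup_M F M.
    apply/seteqP; split=> t [n _].
      by move=> tn; exists n.+1 => //; exists n => //=.
    by move=> [k _ tk]; exists k.
  have mF M : measurable (F M) by apply: bigcup_measurable => n _; exact: mX.
  have ndF : nondecreasing_seq F.
    move=> m n mn; apply/subsetPset => t [k /= km tk]; exists k => //=.
    exact: leq_trans mn.
  rewrite FE; have mFE : measurable (\bigcup_M F M) by rewrite -FE.
  apply: cvge_le _ (nondecreasing_cvg_mu (mu := P) mF mFE ndF).
  apply: nearW => M.
  pose Q (u : nat -> D) :=
    has (fun n => phi n o (u n) < n%:R * (h - lam)) (iota n0 M).
  have FQ : F M = [set t | Q (fun i => X i t)].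
    apply/seteqP; split=> t.
      move=> [n /= nM tn]; apply/hasP; exists (n0 + n)%N => //.
      by rewrite mem_iota leq_addr ltn_add2l.
    move=> /hasP[n]; rewrite mem_iota => /andP[n0n nM] tn.
    by exists (n - n0)%N => /=; [lia|rewrite subnKC].
  rewrite /= FQ (measure_event supp_uniq sum1 hX (n := (n0 + M)%N)).
  + by rewrite lee_fin; exact: hn0.
  + move=> u v uv; apply: eq_in_has => n; rewrite mem_iota => /andP[_ nM].
    by rewrite uv// ltnW.
  + by rewrite -FQ; exact: mF.
move=> t /= /forallNP tN n0 _.
have /existsNP[n /not_implyP[n0n /negP]] := tN n0.
by rewrite -ltNge => tn; exists (n - n0)%N => //; rewrite /small subnKC.
Qed.

(** Markov's inequality at one large time already makes the event that all later surprisals are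
    large improbable. *)
Lemma surprisal_liminf_le h lam : 0 < lam ->
  (forall eps, 0 < eps ->
    exists n0, forall n, (n0 <= n)%N -> dev h n o <= n%:R * eps) ->
  {ae P, forall t, forall n0, exists2 n, (n0 <= n)%N &
    phi n o (X n t) <= n%:R * (h + lam)}.
Proof.
move=> lam0 hdev; apply: ae_foralln => n0.
pose large n := X n @^-1` [set y | n%:R * (h + lam) < phi n o y].
exists (\bigcap_n large (n0 + n)%N); split.
- by apply: bigcapT_measurable => n; exact: mX.
- apply: measure_le_eps_eq0 => eps eps0.
  have [n1 hn1] := hdev _ (mulr_gt0 eps0 lam0).
  pose n := (n0 + n1.+1)%N.
  apply: (@le_trans _ _ (P (large n))).
    apply: le_measure; [apply: mem_set|exact/mem_set/mX|by move=> t; apply].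
    by apply: bigcapT_measurable => k; exact: mX.
  pose Q (u : nat -> D) := n%:R * (h + lam) < phi n o (u n).
  rewrite (_ : large n = [set t | Q (fun i => X i t)])//.
  rewrite (measure_event supp_uniq sum1 hX (n := n)); last 2 first.
  + by move=> u v; rewrite /Q => ->.
  + exact: (mX n [set y | n%:R * (h + lam) < phi n o y]).
  have n_gt0 : 0 < n%:R :> R by rewrite ltr0n /n addnS.
  rewrite lee_fin -(ler_pM2l n_gt0) -(ler_pM2r lam0) -!mulrA.
  apply: le_trans (hn1 n _); last by rewrite /n; lia.
  rewrite mulrA mulrAC -pexpZ; apply: (le_pexp (chain_gt0 chain)) => u _.
  rewrite /Q; case: ltP => [lt|_]; last by rewrite mulr0.
  by rewrite mulr1 (le_trans _ (ler_norm _))//; lra.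
move=> t /= /forall2NP tN n _.
case: (tN (n0 + n)%N) => [|/negP]; first by rewrite leq_addr.
by rewrite -ltNge.
Qed.

Theorem isotropic_chain_entropy : exists h : R,
  [/\ (fun n : nat =>
         - ((n%:R^-1)%:E * 'E_P[(fun t => ln (law P X n (X n t)))%R]))%E
        @ \oo --> h%:E,
      {ae P, forall t,
         limn_einf (fun n : nat => (- (n%:R^-1 * ln (law P X n (X n t))))%:E)
           = h%:E}
    & (fun n : nat =>
         'E_P[(fun t => `|- (n%:R^-1 * ln (law P X n (X n t))) - h|)%R])%E
        @ \oo --> 0%E].
Proof.
have lawE n y : law P X n y = pn p supp n o y by exact: law_pn.
have [h [h0 hle hinf]] := entropy_rate_exists chain o.
have hent := entropy_eventually_le chain h0 hinf.
have hdev := deviation_eventually_le chain h0 hle hinf.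
exists h; split.
- have -> : (fun n : nat =>
      - ((n%:R^-1)%:E * 'E_P[(fun t => ln (law P X n (X n t)))%R]))%E =
      EFin \o (fun n => n%:R^-1 * ent n o).
    apply/funext => n /=.
    rewrite (expectation_state supp_uniq sum1 hX n (fun y => ln (law P X n y))).
    rewrite -EFinM -EFinN -mulrN; congr (_ * _)%:E.
    rewrite -mulN1r -pexpZ; apply: eq_pexp => u _.
    by rewrite mulN1r lawE.
  apply: cvg_EFin; first exact: nearW.
  apply/cvgrPdist_le => eps eps0; have [n0 hn0] := hent _ eps0.
  (* Starting at [n0.+1] excludes [n = 0], where the quotient takes the default value 0. *)
  exists n0.+1 => // n /= n0n; have n_gt0 : 0 < n%:R :> R by rewrite ltr0n; lia.
  have hge : h <= n%:R^-1 * ent n o.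
    by rewrite mulrC ler_pdivlMr// mulrC hle.
  have hlt : n%:R^-1 * ent n o <= h + eps.
    by rewrite mulrC ler_pdivrMr// mulrC hn0// ltnW.
  by rewrite distrC ger0_norm; lra.
- have lower : {ae P, forall t, forall j : nat, exists n0, forall n,
      (n0 <= n)%N -> n%:R * (h - j.+1%:R^-1) <= phi n o (X n t)}.
    by apply: ae_foralln => j; exact: surprisal_liminf_ge.
  have upper : {ae P, forall t, forall j n0 : nat, exists2 n, (n0 <= n)%N &
      phi n o (X n t) <= n%:R * (h + j.+1%:R^-1)}.
    by apply: ae_foralln => j; exact: surprisal_liminf_le.
  apply: filterS2 lower upper => t lower upper.
  have uE n : - (n%:R^-1 * ln (law P X n (X n t))) = phi n o (X n t) / n%:R.
    by rewrite -mulrN mulrC lawE.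
  apply: limn_einf_eq => [j|j n0].
    have [n0 hn0] := lower j; exists n0.+1 => n n0n.
    by rewrite uE ler_pdivlMr ?ltr0n 1?mulrC; [exact/hn0/ltnW|lia].
  have [n n0n hn] := upper j n0.+1; exists n; first exact: ltnW.
  by rewrite uE ler_pdivrMr ?ltr0n 1?mulrC//; lia.
- have E n : 'E_P[(fun t => `|- (n%:R^-1 * ln (law P X n (X n t))) - h|)%R]%E =
      (pexp p supp n o (fun u => `|phi n o (u n) / n%:R - h|))%:E.
    rewrite (expectation_state supp_uniq sum1 hX n
      (fun y => `|- (n%:R^-1 * ln (law P X n y)) - h|)).
    congr EFin; apply: eq_pexp => u _.
    by rewrite lawE -mulrN [in LHS]mulrC.
  under eq_fun do rewrite E.
  apply: cvg_EFin; first exact: nearW.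
  apply/cvgrPdist_le => eps eps0; have [n0 hn0] := hdev _ eps0.
  exists n0.+1 => // n /= n0n; have n_gt0 : 0 < n%:R :> R by rewrite ltr0n; lia.
  rewrite sub0r normrN ger0_norm; last first.
    by apply: (pexp_ge0 (chain_gt0 chain)).
  rewrite -(ler_pM2l n_gt0) -pexpZ; apply: le_trans (hn0 n (ltnW n0n)).
  apply: (le_pexp (chain_gt0 chain)) => u _.
  rewrite -{1}[n%:R]gtr0_norm// -normrM mulrBr mulrCA divff ?gt_eqF//.
  by rewrite mulr1.
Qed.

End EntropyTheorem.

Theorem corollary4p5
  (* irreducible Fuchsian Coxeter system *)
  (N : nat) (W : groupType) (s : 'I_N -> W)
  (hW : fuchsian_coxeter_system s) (hWirr : irreducible_coxeter_system s)
  (* thick regular Fuchsian building with base chamber o *)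
  (D : choiceType) (delta : D -> D -> W) (o : D)
  (hD : building s delta) (hreg : regular_building s delta)
  (hthick : thick_building s delta)
  (* irreducible isotropic random walk with bounded range *)
  (R : realType) (p : D -> D -> R)
  (hp : transition_matrix p) (hpirr : irreducible_walk p)
  (hpiso : isotropic delta p) (hpbd : bounded_range s delta p)
  (d : measure_display) (T : measurableType d) (P : probability T R)
  (X : nat -> T -> D) (hX : markov_chain P p o X) :
  exists h : R,
    [/\ (fun n : nat =>
           - ((n%:R^-1)%:E * 'E_P[(fun t => ln (law P X n (X n t)))%R]))%E
          @ \oo --> h%:E,
        {ae P, forall t,
           limn_einf (fun n : nat => (- (n%:R^-1 * ln (law P X n (X n t))))%:E)
             = h%:E}
      & (fun n : nat =>
           'E_P[(fun t => `|- (n%:R^-1 * ln (law P X n (X n t))) - h|)%R])%E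
          @ \oo --> 0%E].
Proof.
(* The presentation gives word length its parity, on which the building geometry and hence the
   abstract chain rest. *)
have [k [_ _ _ pres]] := hW.
have [e chain] := isotropic_walk_chain pres hD hreg hp hpiso hpbd o.
exact: (isotropic_chain_entropy chain hX).
Qed.
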